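(* Let $d\ge2$ be an integer. Consider the LL($d$) policy with memory and exponential job sizes with mean $1/\mu$, arrival rate $\lambda$ with $0<\rho=\lambda/\mu<1$, and equilibrium probability $\pi_0\in(0,1]$ that the memory is empty. Then the equilibrium workload of the queue at the cavity has complementary cdf $$\bar F(w)=\left(\rho\pi_0+(\rho^{1-d}-\rho\pi_0)\,e^{(d-1)\mu w}\right)^{\frac1{1-d}},\qquad w\ge0 .$$
   Context: Queue at the cavity for LL($d$) (join the least loaded of $d$ queues) with memory in equilibrium: its state is its workload $W\ge0$ (amount of unfinished work), which decreases linearly at rate $1$ while positive and jumps up by the size of each job that joins. The equilibrium law of $W$ has an atom at $0$ and a density on $(0,\infty)$; $\bar F(w)=\mathbb{P}(W>w)$. - Potential arrivals occur at rate $\lambda d\pi_0$. At a potential arrival, $d-1$ i.i.d. workloads with the equilibrium law of $W$ are drawn, independent of $W$; the job joins the queue at the cavity iff its workload is the smallest of the $d$ values, ties being broken uniformly at random. - When $W=0$ there is an additional arrival rate $\lambda(1-\pi_0)/(1-\bar F(0))$ (jobs routed to an idle server whose id is in memory). - Job sizes are i.i.d. exponential with mean $1/\mu$. The equilibrium is a probability law that is stationary for this process with rates computed from that same law. *)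

(* Defs.v *)
From HB Require Import structures.
From mathcomp Require Import all_boot all_order all_algebra.
From mathcomp Require Import all_classical all_reals all_analysis.

Set Implicit Arguments.
Unset Strict Implicit.
Unset Printing Implicit Defensive.
Import Order.TTheory GRing.Theory Num.Theory.
Import numFieldNormedType.Exports.

Local Open Scope classical_set_scope.
Local Open Scope ring_scope.

(** * A queue drained at unit rate, with state-dependent arrivals

   The workload is a piecewise deterministic Markov process on [0, +oo[: it
   follows [drain] between jumps; started from w, its first jump occurs after
   time s with probability [survival rate w s]; each jump adds an independent
   size with density [size_pdf]. *)

Definition drain {R : realType} (w s : R) : R := Num.max 0 (w - s).

Definition survival {R : realType} (rate : R -> R) (w s : R) : R :=
  expR (- (\int[@lebesgue_measure R]_(u in `[0, s]) rate (drain w u))).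

(** Probability that the workload started from [w] lies in [A] at time [t],
   with exactly [n] jumps during [0, t]; for n > 0 one conditions on the time
   s and on the size x of the first jump. *)
Fixpoint njump_transition {R : realType} (rate size_pdf : R -> R) (n : nat)
    (t w : R) (A : set R) : \bar R :=
  match n with
  | 0%N => (survival rate w t * \1_A (drain w t))%:E
  | m.+1 =>
      (\int[@lebesgue_measure R]_(s in `[0%R, t])
         ((rate (drain w s) * survival rate w s)%:E *
          \int[@lebesgue_measure R]_x
            ((size_pdf x)%:E *
             njump_transition rate size_pdf m (t - s)%R (drain w s + x)%R A)))%E
  end.

Definition transition {R : realType} (rate size_pdf : R -> R) (t w : R)
    (A : set R) : \bar R :=
  (\sum_(0 <= n <oo) njump_transition rate size_pdf n t w A)%E.

Definition stationary {R : realType} (rate size_pdf : R -> R)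
    (nu : probability R R) : Prop :=
  forall (t : R) (A : set R), 0 <= t -> measurable A ->
    (\int[nu]_w transition rate size_pdf t w A)%E = nu A.

(** * LL(d) with memory: the rates of the queue at the cavity *)

(** Expectation of [f [:: v_1; ...; v_n]] for v_1, ..., v_n i.i.d. with law
   [nu], as an iterated integral. *)
Fixpoint iid_expectation {R : realType} (nu : probability R R) (n : nat)
    (f : seq R -> \bar R) : \bar R :=
  match n with
  | 0%N => f [::]
  | m.+1 => (\int[nu]_v iid_expectation nu m (fun vs => f (v :: vs)))%E
  end.

(** Probability that a job joins a queue with workload [w] when the other
   sampled workloads are [vs]: the queue must attain the minimum, and a uniform
   choice is made among the queues that do. *)
Definition tie_share {R : realType} (w : R) (vs : seq R) : R :=
  if all (fun v => w <= v) vs then (count_mem w vs).+1%:R^-1 else 0.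

Definition join_prob {R : realType} (d : nat) (nu : probability R R) (w : R) : R :=
  fine (iid_expectation nu d.-1 (fun vs => (tie_share w vs)%:E)).

(** Potential arrivals (rate lam d pi0) thinned by [join_prob], plus, at an idle
   queue, the jobs routed through the memory; [nu `]0, +oo[] is P(W > 0). *)
Definition arrival_rate {R : realType} (d : nat) (lam pi0 : R)
    (nu : probability R R) (w : R) : R :=
  lam * d%:R * pi0 * join_prob d nu w +
  (if w == 0 then lam * (1 - pi0) / (1 - fine (nu `]0, +oo[%classic)) else 0).

(** The rates depend on the law [nu] itself, which makes this a fixed-point
   condition. *)
Record equilibrium_workload {R : realType} (d : nat) (lam mu pi0 : R)
    (nu : probability R R) : Prop := EquilibriumWorkload {
  workload_ge0 : nu `]-oo, 0[%classic = 0%E ;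
  workload_atom0 : (0 < nu [set 0%R])%E ;
  workload_density : exists f : R -> R,
    [/\ measurable_fun setT f, (forall x, 0 <= f x) &
      forall A : set R, measurable A -> A `<=` `]0, +oo[ ->
        nu A = (\int[@lebesgue_measure R]_(x in A) (f x)%:E)%E] ;
  workload_stationary :
    stationary (arrival_rate d lam pi0 nu) (exponential_pdf mu) nu
}.

(* Main.v *)
(* Starting from W = w, during a short time t the workload exceeds x at the end
   either because w > x + t or because of a jump above x; stationarity then says
   that the downward flow through a level balances the jumps above it.  Writing
   F for the tail of the law and r for the arrival rate, this gives, for x > 0,
     F' = - g   with   g(x) = e^(- mu x) int_[0, x] r(w) e^(mu w) d nu(w),
   so that g' = (r - mu) g.  As r = lam d pi0 F^(d-1) on (0, +oo), the quantity
   g - mu F + lam pi0 F^d is constant; its values at 0 and at infinity give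
   F(0) = rho and the Bernoulli equation F' = - mu F (1 - rho pi0 F^(d-1)).
   With Y the base of the announced power, Q = F^(d-1) Y satisfies
   Q' = c (Q - 1) with c bounded and Q(0) = 1, hence Q = 1 by Gronwall. *)

Require Import Defs.
From HB Require Import structures.
From mathcomp Require Import all_boot all_order all_algebra.
From mathcomp Require Import all_classical all_reals all_analysis.
From mathcomp Require Import measurable_realfun.
From mathcomp Require Import ring lra.

Import Order.TTheory GRing.Theory Num.Theory.
Import numFieldNormedType.Exports.
Local Open Scope classical_set_scope.
Local Open Scope ring_scope.

(** The law has a density about which only measurability is known, so the slope of its tail cannot
    be read off and has to be extracted from stationarity at small times, the kernel being a series
    over the number of jumps. This asks for a two-sided expansion at every starting point whose
    error stays small after integration against the law. That error is second order in t up to two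
    terms: the oscillation of the rate while draining, which goes away by dominated convergence, and
    the mass of a strip of width t above the level, which goes away by continuity of the tail. The
    derivative of g is also found without the density: on ]0, +oo[ the rate is nonincreasing and
    e^(mu w) is increasing, so increments of the integral are squeezed between multiples of
    increments of F. Because of the extra arrivals and the atom at 0, derivatives are taken on the
    open half-line only and joined to 0 by right limits. Finally, linearising the Bernoulli equation
    would divide by F, not yet known to be positive; the product Q avoids the division. *)

(** * Pointwise bounds on integrals *)

(* No measurability is assumed: [njump_transition] is an iterated integral whose
   measurability in the starting point is never needed. *)
Lemma le_integral_pointwise d (T : measurableType d) (R : realType)
    (m : {measure set T -> \bar R}) (D : set T) (f g : T -> \bar R) :
  (forall x, D x -> (f x <= g x)%E) ->
  (\int[m]_(x in D) f x <= \int[m]_(x in D) g x)%E.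
Proof.
have ge0_le (h k : T -> \bar R) : (forall x, 0 <= h x)%E ->
    (forall x, D x -> h x <= k x)%E -> (forall x, 0 <= k x)%E ->
    (\int[m]_(x in D) h x <= \int[m]_(x in D) k x)%E.
  move=> h0 hk k0; rewrite !ge0_integralE//.
  apply: ge_ereal_sup => _ [u /= uh <-]; apply: ereal_sup_ubound.
  by exists u => //= x; rewrite (le_trans (uh x))// lee_restrict.
move=> fg; rewrite integralE [leRHS]integralE leeB//; apply: ge0_le => // x Dx.
- by apply: (@funepos_le _ _ D); [move=> ? /set_mem; exact: fg | exact/mem_set].
- by apply: (@funeneg_le _ _ D); [move=> ? /set_mem; exact: fg | exact/mem_set].
Qed.

Lemma integral_cst_itv0c (R : realType) (c t : R) : 0 <= t ->
  (\int[@lebesgue_measure R]_(s in `[0%R, t]) c%:E = (c * t)%:E)%E.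
Proof.
move=> t0; rewrite integral_cst//= lebesgue_measure_itv/= lte_fin.
by case: ltgtP t0 => // [_|<-] _; rewrite ?oppr0 ?adde0 -EFinM ?subr0.
Qed.

Lemma integral_itv0c_bounds (R : realType) (f : R -> \bar R) (lo hi t : R) :
  0 <= t ->
  (forall s, 0 <= s <= t -> (lo%:E <= f s <= hi%:E)%E) ->
  ((lo * t)%:E <= \int[@lebesgue_measure R]_(s in `[0%R, t]) f s <= (hi * t)%:E)%E.
Proof.
move=> t0 fb; rewrite -!integral_cst_itv0c//; apply/andP; split;
  apply: le_integral_pointwise => s /=; rewrite in_itv/= => /fb /andP[] //.
Qed.

Lemma Rintegral_itv0c_bounds (R : realType) (f : R -> R) (lo hi t : R) :
  0 <= t -> (forall s, 0 <= s <= t -> lo <= f s <= hi) ->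
  lo * t <= \int[@lebesgue_measure R]_(s in `[0%R, t]) f s <= hi * t.
Proof.
move=> t0 fb; rewrite /Rintegral.
have /andP[] := @integral_itv0c_bounds R (EFin \o f) lo hi t t0 fb.
by case: integral => //= x; rewrite !lee_fin => -> ->.
Qed.

Lemma pdf_average_bounds (R : realType) (e : R -> R) (h : R -> \bar R) (c : R) :
  measurable_fun setT e -> (forall x, 0 <= e x) ->
  (\int[@lebesgue_measure R]_x (e x)%:E = 1)%E ->
  (forall x, (0 <= h x <= c%:E)%E) ->
  (0 <= \int[@lebesgue_measure R]_x ((e x)%:E * h x) <= c%:E)%E.
Proof.
move=> me e0 e1 hc; have c0 : 0 <= c.
  by have /andP[h0 h1] := hc 0; rewrite -lee_fin (le_trans h0).
apply/andP; split.
  by apply: integral_ge0 => x _; rewrite mule_ge0 ?lee_fin//; case/andP: (hc x).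
apply: (@le_trans _ _ (\int[@lebesgue_measure R]_x ((e x)%:E * c%:E))%E).
  apply: le_integral_pointwise => x _; apply: lee_wpmul2l; rewrite ?lee_fin//.
  by case/andP: (hc x).
rewrite ge0_integralZr//; first last.
- by move=> x _; rewrite lee_fin.
- exact/measurable_EFinP.
by rewrite e1 mul1e.
Qed.

(** * Few jumps in a short time *)

Section transition_bounds.
Context {R : realType} (r e : R -> R) (C : R).
Hypothesis r0C : forall w, 0 <= r w <= C.
Hypothesis me : measurable_fun setT e.
Hypothesis e0 : forall x, 0 <= e x.
Hypothesis e1 : (\int[@lebesgue_measure R]_x (e x)%:E = 1)%E.

Let C0 : 0 <= C.
Proof. by have /andP[] := r0C 0; exact: le_trans. Qed.

Lemma survival_bounds w t : 0 <= t -> 0 <= survival r w t <= 1.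
Proof.
move=> t0; rewrite /survival expR_ge0/= -[leRHS]expR0 ler_expR oppr_le0.
by apply: Rintegral_ge0 => s _; case/andP: (r0C (drain w s)).
Qed.

(** Each jump costs a factor at most C t, since the rate is at most C and the remaining time at most
    t. The sharper factor 1/n! is given up: a geometric bound is enough for short times. *)
Lemma njump_transition_bounds n t w A : 0 <= t ->
  (0 <= njump_transition r e n t w A <= ((C * t) ^+ n)%:E)%E.
Proof.
elim: n t w => [|n IH] t w t0 /=.
  have /andP[s0 s1] := survival_bounds w t t0.
  rewrite !lee_fin expr0 mulr_ge0//= indicE.
  by case: (_ \in _); rewrite ?mulr1 ?mulr0.
rewrite (_ : (C * t) ^+ n.+1 = C * (C * t) ^+ n * t); last by rewrite exprS; ring.
have := @integral_itv0c_bounds R (fun s => ((r (drain w s) * survival r w s)%:E *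
  \int[@lebesgue_measure R]_x ((e x)%:E *
    njump_transition r e n (t - s) (drain w s + x) A))%E)
  0 (C * (C * t) ^+ n) t t0.
rewrite mul0r; apply => s /andP[s0 st].
have ts0 : 0 <= t - s by rewrite subr_ge0.
have /andP[i0 i1] : (0 <= \int[@lebesgue_measure R]_x ((e x)%:E *
    njump_transition r e n (t - s) (drain w s + x) A) <= ((C * t) ^+ n)%:E)%E.
  apply: pdf_average_bounds => // x.
  have /andP[-> h] := IH (t - s) (drain w s + x) ts0; apply: (le_trans h).
  rewrite lee_fin lerXn2r ?nnegrE ?mulr_ge0//.
  by rewrite ler_wpM2l// gerBl.
have /andP[rr0 rr1] := r0C (drain w s).
have /andP[s0' s1] := survival_bounds w s s0.
apply/andP; split; first by rewrite mule_ge0 ?lee_fin ?mulr_ge0.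
rewrite (EFinM C); apply: lee_pmul => //; first by rewrite lee_fin mulr_ge0.
by rewrite lee_fin -[leRHS]mulr1 ler_pM.
Qed.

(** Two or more jumps are a second-order event: the geometric tail (C t)^2 / (1 - C t) is at most 2
    (C t)^2 once C t <= 1/2. *)
Lemma transition_split t w A : 0 <= t -> C * t <= 1 / 2 ->
  (njump_transition r e 0 t w A + njump_transition r e 1 t w A
   <= transition r e t w A
   <= njump_transition r e 0 t w A + njump_transition r e 1 t w A
      + (2 * (C * t) ^+ 2)%:E)%E.
Proof.
move=> t0 Ct; have Ct0 : 0 <= C * t by rewrite mulr_ge0.
have p0 n : (0 <= njump_transition r e n t w A)%E.
  by have /andP[] := njump_transition_bounds n t w A t0.
rewrite /transition (nneseries_split 0%N 2%N)// !add0n.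
rewrite big_mkord !big_ord_recr big_ord0 /= add0e.
apply/andP; split.
  by rewrite leeDl// nneseries_ge0// => n _ _; exact: p0.
apply: leeD2l.
apply: (@le_trans _ _ (\sum_(2 <= n <oo) (geometric 1 (C * t) n)%:E)%E).
  apply: lee_nneseries => // n _ /=; rewrite mul1r.
  by have /andP[] := njump_transition_bounds n t w A t0.
have -> : (\sum_(2 <= n <oo) (geometric 1 (C * t) n)%:E =
  \sum_(0 <= n <oo) (geometric ((C * t) ^+ 2) (C * t) n)%:E)%E.
  rewrite -(@nneseries_addn _ _ 2%N) => [|n]; last by rewrite lee_fin/= mul1r exprn_ge0.
  by apply: eq_eseriesr => n _ /=; rewrite mul1r exprD mulrC.
have Ct1 : `|C * t| < 1 by rewrite ger0_norm//; lra.
have -> : (\sum_(0 <= n <oo) (geometric ((C * t) ^+ 2) (C * t) n)%:E =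
  ((C * t) ^+ 2 / (1 - C * t))%:E)%E.
  apply/cvg_lim => //; under eq_fun do rewrite sumEFin.
  by apply: cvg_EFin; [exact: nearW | exact: cvg_geometric_series].
rewrite lee_fin mulrC ler_wpM2r ?exprn_ge0// -[leRHS]invrK lef_pV2 ?posrE//; lra.
Qed.
End transition_bounds.

(** * Tail of the job size *)

(** The probability that a job exceeds z; the maximum gives 1 for z <= 0, the case of a state
    already above the level. *)
Definition exponential_tail {R : realType} (mu z : R) : R :=
  expR (- mu * Num.max 0 z).

Lemma exponential_tail_bounds (R : realType) (mu z : R) :
  0 < mu -> 0 <= exponential_tail mu z <= 1.
Proof.
move=> mu0; rewrite expR_ge0/= -[leRHS]expR0 ler_expR mulNr oppr_le0.
by rewrite mulr_ge0 ?le_max ?lexx// ltW.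
Qed.

Lemma exponential_tail1 (R : realType) (mu z : R) :
  z <= 0 -> exponential_tail mu z = 1.
Proof. by move=> z0; rewrite /exponential_tail max_l// mulr0 expR0. Qed.

Lemma exponential_tailD_ge (R : realType) (mu z t : R) :
  0 < mu -> 0 <= t ->
  exponential_tail mu z * (1 - mu * t) <= exponential_tail mu (z + t).
Proof.
move=> mu0 t0; apply: (@le_trans _ _ (exponential_tail mu z * expR (- mu * t))).
  by rewrite ler_wpM2l ?expR_ge0// -mulNr expR_ge1Dx.
rewrite -expRD ler_expR -mulrDr !mulNr lerN2 ler_pM2l//.
by rewrite ge_max addr_ge0 ?le_max ?lexx//= lerD2r le_max lexx orbT.
Qed.

Lemma integral_exponential_tail (R : realType) (mu z : R) : 0 < mu ->
  (\int[@lebesgue_measure R]_y ((exponential_pdf mu y)%:E * (\1_(`]z, +oo[) y)%:E)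
   = (exponential_tail mu z)%:E)%E.
Proof.
move=> mu0.
transitivity (exponential_prob mu `]z, +oo[%classic).
  rewrite /exponential_prob [RHS]integral_mkcond; apply: eq_integral => y _.
  by rewrite patchE indicE; case: ifP; rewrite ?mule1 ?mule0.
have -> : exponential_prob mu `]z, +oo[%classic =
    (1 - exponential_prob mu `]-oo, z]%classic)%E.
  rewrite -[in LHS]setCitvl.
  by rewrite -(@probability_setC _ _ _ (exponential_prob mu)).
have [z0|z0] := leP z 0.
  rewrite exponential_tail1// [exponential_prob _ _](_ : _ = 0%E) ?sube0//.
  (* Dropping the endpoint matters when z = 0: the density vanishes at negative points but not at
     0. *)
  rewrite /exponential_prob -integral_itv_bndo_bndc; last first.
    by apply/measurable_EFinP/measurable_funTS; exact: measurable_exponential_pdf.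
  apply: integral0_eq => y /=; rewrite in_itv/= => yz.
  by rewrite lt0_exponential_pdf// (lt_le_trans yz).
have -> : exponential_prob mu `]-oo, z]%classic = exponential_prob mu `[0, z]%classic.
  rewrite /exponential_prob [LHS]integral_mkcond [RHS]integral_mkcond.
  apply: eq_integral => y _; rewrite !patchE !mem_setE/= !in_itv/=.
  by case: (leP 0 y) => //= y0; rewrite lt0_exponential_pdf//; case: ifP.
rewrite exponential_prob_itv0c// /exponential_tail max_r ?ltW//.
by rewrite -[1%E]/(1%:E) -!EFinB subKr.
Qed.

(** * Short-time expansion of the probability of ending above a level *)

(** Multiply by e^y >= 1 + y and use (1 - y + y^2) (1 + y) = 1 + y^3. *)
Lemma expRN_le (R : realType) (y : R) : 0 <= y -> expR (- y) <= 1 - y + y ^+ 2.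
Proof.
move=> y0; rewrite expRN -[leLHS]mul1r ler_pdivrMr ?expR_gt0//.
apply: (@le_trans _ _ ((1 - y + y ^+ 2) * (1 + y))).
  have : 0 <= y ^+ 3 by rewrite exprn_ge0.
  by rewrite [X in _ -> _ <= X](_ : _ = 1 + y ^+ 3); [lra|ring].
rewrite ler_wpM2l ?expR_ge1Dx//.
have : 0 <= (1 - y) ^+ 2 by exact: sqr_ge0.
by rewrite [X in _ <= X -> _](_ : _ = 1 - y + y ^+ 2 - y); [lra|ring].
Qed.

Lemma drain_ltE (R : realType) (x w s : R) : 0 <= x -> (x < drain w s) = (x + s < w).
Proof. by move=> x0; rewrite /drain lt_max ltNge x0/= ltrBrDr. Qed.

Lemma indic_itvoy (R : realType) (x y : R) : \1_(`]x, +oo[%classic) y = (x < y)%R%:R :> R.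
Proof. by rewrite indicE mem_setE in_itv/= andbT. Qed.

Section short_time_expansion.
Context {R : realType} (r : R -> R) (C mu w x t dl : R).
Hypothesis r0C : forall w, 0 <= r w <= C.
Hypothesis mu0 : 0 < mu.
Hypothesis w0 : 0 <= w.
Hypothesis x0 : 0 <= x.
Hypothesis t0 : 0 <= t.
Hypothesis dl0 : 0 <= dl.
Hypothesis rdl : forall s, 0 <= s <= t -> r w - dl <= r (drain w s) <= r w + dl.

(** The lower bound on the rate is clamped at 0 so that lower bounds can be multiplied. *)
Let lo := Num.max 0 (r w - dl).
Let hi := r w + dl.

Let C0 : 0 <= C.
Proof. by have /andP[] := r0C 0; exact: le_trans. Qed.

Let rlohi s : 0 <= s <= t -> lo <= r (drain w s) <= hi.
Proof.
move=> /rdl /andP[h1 h2]; rewrite h2 andbT ge_max h1 andbT.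
by case/andP: (r0C (drain w s)).
Qed.

Lemma survival_ge v s : 0 <= s -> 1 - C * s <= survival r v s.
Proof.
move=> s0; rewrite /survival; apply: le_trans (expR_ge1Dx _).
rewrite lerD2l lerN2.
by have /andP[] := Rintegral_itv0c_bounds _ (fun u => r (drain v u)) 0 C s s0
  (fun u _ => r0C _).
Qed.

Lemma survival_expansion :
  1 - hi * t <= survival r w t <= 1 - lo * t + (C * t) ^+ 2.
Proof.
rewrite /survival; pose rw u := r (drain w u).
have /andP[] := Rintegral_itv0c_bounds _ rw lo hi t t0 rlohi.
have /andP[] := Rintegral_itv0c_bounds _ rw 0 C t t0 (fun u _ => r0C _).
rewrite mul0r; set I := Rintegral _ _ _ => I0 IC Ilo Ihi; apply/andP; split.
  by apply: le_trans (expR_ge1Dx _); rewrite lerD2l lerN2.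
apply: (le_trans (expRN_le _ _ I0)).
have : I ^+ 2 <= (C * t) ^+ 2 by rewrite lerXn2r// nnegrE (le_trans I0).
by lra.
Qed.

Let A := `]x, +oo[%classic : set R.
Let landing s :=
  (\int[@lebesgue_measure R]_y ((exponential_pdf mu y)%:E *
     (survival r (drain w s + y) (t - s) * \1_A (drain (drain w s + y) (t - s)))%:E))%E.

Let e0 y : 0 <= exponential_pdf mu y.
Proof. by rewrite exponential_pdf_ge0// ltW. Qed.

(** After a jump of size y at time s, the state at time t without further jump is above x only if y
    > x - w, and certainly if y > x - w + t, because [drain w s] lies between w - s and w. Avoiding
    a further jump costs at most a factor 1 - C t. *)
Lemma landing_bounds s : 0 <= s <= t ->
  (((1 - C * t) * exponential_tail mu (x - w + t))%:E <= landing s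
   <= (exponential_tail mu (x - w))%:E)%E.
Proof.
move=> /andP[s0 st]; have ts0 : 0 <= t - s by rewrite subr_ge0.
have ds : w - s <= drain w s <= w.
  by rewrite /drain le_max lexx orbT/= ge_max w0 gerBl.
apply/andP; split; last first.
  rewrite -integral_exponential_tail//; apply: le_integral_pointwise => y _.
  rewrite lee_wpmul2l ?lee_fin// !indic_itvoy drain_ltE//.
  have /andP[s1 s2] := survival_bounds r C r0C (drain w s + y) (t - s) ts0.
  have [h|h] := ltP; rewrite ?mulr0 ?mulr1//.
  by rewrite (_ : x - w < y)//; lra.
rewrite EFinM -integral_exponential_tail//.
have mt : measurable_fun setT (fun y : R => (exponential_pdf mu y)%:E *
    (\1_(`]x - w + t, +oo[%classic) y)%:E)%E.
  apply: emeasurable_funM; apply/measurable_EFinP => //.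
  exact: measurable_exponential_pdf.
rewrite -integralZl//; last first.
  apply/integrableP; split => //.
  under eq_integral do rewrite gee0_abs ?mule_ge0 ?lee_fin//.
  by rewrite integral_exponential_tail// ltry.
apply: le_integral_pointwise => y _.
rewrite muleCA; apply: lee_wpmul2l; rewrite ?lee_fin//.
rewrite !indic_itvoy drain_ltE//.
have [h|h] := ltP (x - w + t) y; rewrite ?mulr0 ?mulr1; last first.
  by rewrite mulr_ge0//; case/andP: (survival_bounds r C r0C (drain w s + y) (t - s) ts0).
rewrite (_ : _ < _ = true) ?mulr1; last by lra.
apply: le_trans (survival_ge _ _ ts0).
by rewrite lerD2l lerN2 ler_wpM2l// gerBl.
Qed.

Lemma njump1_bounds : C * t <= 1 ->
  ((lo * (1 - C * t) * ((1 - C * t) * exponential_tail mu (x - w + t)) * t)%:E <=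
   njump_transition r (exponential_pdf mu) 1 t w A <=
   (hi * exponential_tail mu (x - w) * t)%:E)%E.
Proof.
move=> Ct; apply: integral_itv0c_bounds => // s st.
have /andP[l1 l2] := landing_bounds s st.
have /andP[r1 r2] := rlohi s st.
have /andP[s0 s1] := st.
have /andP[v0 v1] := survival_bounds r C r0C w s s0.
have v2 := survival_ge w s s0.
have rr0 : 0 <= r (drain w s) by case/andP: (r0C (drain w s)).
have lo0 : 0 <= lo by rewrite /lo le_max lexx.
have T0 z : 0 <= exponential_tail mu z by case/andP: (exponential_tail_bounds R mu z mu0).
have Cts : 0 <= 1 - C * t by rewrite subr_ge0.
rewrite -/(landing s) !EFinM; apply/andP; split.
  rewrite -!EFinM (EFinM (lo * _)); apply: lee_pmul => //.
  - by rewrite lee_fin mulr_ge0.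
  - by rewrite lee_fin mulr_ge0.
  - rewrite lee_fin ler_pM//; apply: le_trans v2.
    by rewrite lerD2l lerN2 ler_wpM2l.
rewrite -EFinM; apply: lee_pmul => //.
- by rewrite lee_fin mulr_ge0.
- by apply: le_trans l1; rewrite lee_fin mulr_ge0.
- by rewrite lee_fin -[leRHS]mulr1 ler_pM.
Qed.

(* [k] is the rate of jumps above the level [x] from [w]: only [w <= x] counts,
   and the remaining jumps are absorbed in [err]. *)
Lemma transition_expansion :
  let k := (w <= x)%R%:R * (r w * exponential_tail mu (x - w)) in
  let err := 2 * dl + (5 * C ^+ 2 + C * mu) * t + C * (x < w <= x + t)%R%:R in
  C * t <= 1 / 2 -> mu * t <= 1 ->
  (((x + t < w)%R%:R + t * k - t * err)%:E <=
   transition r (exponential_pdf mu) t w A <=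
   ((x + t < w)%R%:R + t * k + t * err)%:E)%E.
Proof.
set T := exponential_tail mu (x - w); move=> k err Ct mut.
have Ct1 : C * t <= 1 by lra.
have Ct0 : 0 <= C * t by rewrite mulr_ge0.
have mt0 : 0 <= mu * t by rewrite mulr_ge0// ltW.
have /andP[n1 n2] := njump1_bounds Ct1.
have me := measurable_exponential_pdf mu.
have /andP[t1 t2] := transition_split r (exponential_pdf mu) C r0C
  me e0 (integral_exponential_pdf mu0) t w A t0 Ct.
have /andP[v1 v2] := survival_expansion.
have /andP[T0 T1] : 0 <= T <= 1 by exact: exponential_tail_bounds.
have /andP[rw0 rwC] := r0C w.
have lo0 : 0 <= lo by rewrite /lo le_max lexx.
have lodl : r w - dl <= lo by rewrite /lo le_max lexx orbT.
have lor : lo <= r w by rewrite /lo ge_max rw0 gerBl.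
have loC : lo <= C by rewrite (le_trans lor).
have hiE : hi = r w + dl by [].
rewrite hiE in v1.
(* The constant in [err] adds up three second-order errors: (2 C + mu) C from this bound, C^2 from
   the survival probability and 2 C^2 from two or more jumps. *)
have n1' : ((lo * t * T - (2 * C + mu) * C * t ^+ 2)%:E <=
    njump_transition r (exponential_pdf mu) 1 t w A)%E.
  apply: le_trans n1; rewrite lee_fin.
  have q : (1 - 2 * (C * t) - mu * t) * T <=
      (1 - C * t) * ((1 - C * t) * exponential_tail mu (x - w + t)).
    apply: (@le_trans _ _ ((1 - C * t) * ((1 - C * t) * (T * (1 - mu * t))))).
      rewrite (_ : _ * (_ * _) = (1 - C * t) ^+ 2 * (1 - mu * t) * T); last by ring.
      rewrite ler_wpM2r//.
      rewrite -subr_ge0.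
      rewrite (_ : _ - _ = (C * t) ^+ 2 * (1 - mu * t) + 2 * (C * t) * (mu * t));
        last by ring.
      by rewrite addr_ge0// mulr_ge0// ?exprn_ge0 ?mulr_ge0//; lra.
    by rewrite !ler_wpM2l ?subr_ge0// exponential_tailD_ge.
  apply: (@le_trans _ _ (lo * t * ((1 - 2 * (C * t) - mu * t) * T))); last first.
    rewrite [leRHS](_ : _ = lo * t *
      ((1 - C * t) * ((1 - C * t) * exponential_tail mu (x - w + t)))); last by ring.
    by rewrite ler_wpM2l// mulr_ge0.
  rewrite -subr_ge0 (_ : _ - _ = (2 * C + mu) * t * t * (C - lo * T)); last by ring.
  rewrite mulr_ge0 ?subr_ge0//.
    by rewrite mulr_ge0// mulr_ge0// addr_ge0 ?mulr_ge0// ltW.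
  by rewrite -[leRHS]mulr1 ler_pM.
have dlt : 0 <= dl * t by rewrite mulr_ge0.
have C2t : 0 <= C ^+ 2 * t ^+ 2 by rewrite mulr_ge0// exprn_ge0.
have Cmt : 0 <= C * mu * t ^+ 2 by rewrite mulr_ge0 ?exprn_ge0// mulr_ge0// ltW.
have P0E : njump_transition r (exponential_pdf mu) 0 t w A =
    (survival r w t * (x + t < w)%R%:R)%:E by rewrite /= indic_itvoy drain_ltE.
rewrite P0E in t1 t2.
have lot : lo * t * T <= lo * t by rewrite -[leRHS]mulr1 ler_wpM2l// mulr_ge0.
have lott : (r w - dl) * t <= lo * t by rewrite ler_wpM2r.
have lortT : (r w - dl) * t * T <= lo * t * T by rewrite ler_wpM2r// ler_wpM2r.
have dltT : dl * t * T <= dl * t by rewrite -[leRHS]mulr1 ler_wpM2l.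
have rt : r w * t <= C * t by rewrite ler_wpM2r.
have rtT : 0 <= r w * t by rewrite mulr_ge0.
have hit : 0 <= lo * t * T by rewrite mulr_ge0// mulr_ge0.
apply/andP; split.
  apply: le_trans t1; apply: le_trans (leeD2l _ n1'); rewrite -EFinD lee_fin.
  rewrite /k /err; have [wx|wx] := leP w x; rewrite /= ?mulr0 ?mulr1 ?mul0r ?mul1r.
    have -> : (x + t < w) = false by apply/negbTE; rewrite -leNgt (le_trans wx)// lerDl.
    by rewrite /=; lra.
  (* From w > x + t a jump leaves the state above the level: to first order, what survival loses the
     one-jump term gives back. Each of the two is off by at most [dl * t], hence [2 * dl]. *)
  have TE : T = 1 by rewrite /T exponential_tail1// subr_le0 ltW.
  rewrite TE in hit lot lortT dltT *.
  have [wt|wt] := leP w (x + t); rewrite /= ?mulr0 ?mulr1 ?addr0.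
    by lra.
  by lra.
apply: (le_trans t2).
apply: (@le_trans _ _ ((survival r w t * (x + t < w)%R%:R)%:E + (hi * T * t)%:E
    + (2 * (C * t) ^+ 2)%:E)%E).
  by rewrite leeD2r// leeD2l.
rewrite -!EFinD lee_fin hiE.
rewrite /k /err; have [wx|wx] := leP w x; rewrite /= ?mulr0 ?mulr1 ?mul0r ?mul1r.
  have -> : (x + t < w) = false by apply/negbTE; rewrite -leNgt (le_trans wx)// lerDl.
    by rewrite /=; lra.
have TE : T = 1 by rewrite /T exponential_tail1// subr_le0 ltW.
(* In the strip x < w <= x + t draining alone ends below the level but one jump may end above it;
   the indicator term of [err] pays for this. *)
have [wt|wt] := leP w (x + t); rewrite /= ?mulr0 ?mulr1 ?addr0 TE.
  by lra.
by lra.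
Qed.
End short_time_expansion.

(** * Derivatives from difference quotients *)

Section derivative_tools.
Context {R : realType}.
Implicit Types f e : R -> R.

Lemma cvg_shift_dnbhs0 f (x l : R) :
  f y @[y --> x] --> l -> f (x + h) @[h --> 0^'] --> l.
Proof.
have sh : x + h @[h --> 0^'] --> x.
  by rewrite -[X in _ --> X]addr0; apply: cvgD; [exact: cvg_cst | exact: cvg_within].
exact: cvg_comp.
Qed.

Lemma cvg_expRM (a x : R) : expR (a * y) @[y --> x] --> expR (a * x).
Proof.
have ax : a * y @[y --> x] --> a * x by apply: cvgM; [exact: cvg_cst | exact: cvg_id].
exact: (cvg_comp _ _ ax (@continuous_expR R _)).
Qed.

Lemma is_derive_expRM (a x : R) :
  is_derive x 1 (fun y => expR (a * y)) (a * expR (a * x)).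
Proof.
have dl : is_derive x 1 (fun y : R => a * y) a.
  by apply: is_derive_eq; rewrite /GRing.scale/= mulr1.
by have := is_derive1_comp (is_derive_expR (a * x)) dl; rewrite mulrC.
Qed.

Lemma is_deriveX_fun f k (x df : R) : is_derive x 1 f df ->
  is_derive x 1 (fun y => f y ^+ k) (k%:R * f x ^+ k.-1 * df).
Proof. by move=> fd; have := is_deriveX k fd; rewrite exprfctE. Qed.

Lemma cvg_normr_dnbhs0 : `|h| @[h --> (0 : R)^'] --> (0 : R)^'+.
Proof.
move=> A [e /= e0 he]; exists e => //= h hb h0; apply: he => /=.
  by move: hb; rewrite /= /ball_ /= !sub0r !normrN normr_id.
by rewrite normr_gt0.
Qed.

Lemma is_derive_squeeze f e (x l : R) :
  e h @[h --> 0^'] --> 0 ->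
  (\forall h \near 0^', `|f (x + h) - f x - h * l| <= `|h| * e h) ->
  is_derive x 1 f l.
Proof.
move=> e0 fe.
have fl : h^-1 *: (f (h *: 1 + x) - f x) @[h --> 0^'] --> l.
  apply/cvgrPdist_le => eps eps0; near=> h.
  have h0 : h != 0 by near: h; exact: nbhs_dnbhs_neq.
  rewrite scaler1 [h + x]addrC (_ : l - _ = - (h^-1 * (f (x + h) - f x - h * l))); last first.
    by rewrite /GRing.scale/= [in RHS]mulrBr mulKf//; ring.
  rewrite normrN normrM normfV ler_pdivrMl ?normr_gt0//.
  apply: (@le_trans _ _ (`|h| * e h)); first by near: h.
  rewrite ler_wpM2l//; apply: (le_trans (ler_norm _)).
  by near: h; exact: (cvgr0_norm_le _ e0).
by apply: DeriveDef; [exact: cvgP fl | exact: cvg_lim fl].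
Unshelve. all: by end_near. Qed.

Lemma is_derive_cvg f (x l : R) : is_derive x 1 f l ->
  h^-1 * (f (x + h) - f x) @[h --> 0^'] --> l.
Proof.
move=> [fd <-]; apply: cvg_trans fd; apply: near_eq_cvg; apply: nearW => h.
by rewrite /= scaler1 [h + x]addrC.
Qed.

(** Only a right limit is asked at 0: a tail probability jumps there from the left when the law has
    an atom at 0. *)
Lemma le_at0_of_derive_le0 f (df : R -> R) :
  (forall x : R, 0 < x -> is_derive x 1 f (df x)) ->
  (forall x, 0 < x -> df x <= 0) ->
  f x @[x --> 0^'+] --> f 0 -> forall x, 0 <= x -> f x <= f 0.
Proof.
move=> fd df0 f0 b; rewrite le_eqVlt => /predU1P[<-//|b0].
have [||c /andP[c0 _]] := @MVT _ f df 0 b b0.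
- by move=> x; rewrite in_itv/= => /andP[x0 _]; exact: fd.
- have fc x : 0 < x -> {for x, continuous f}.
    by move=> /fd fdx; apply/differentiable_continuous/derivable1_diffP.
  apply/continuous_within_itvP => //; split => //.
  + by move=> x; rewrite in_itv/= => /andP[x0 _]; exact: fc.
  + by apply: cvg_at_left_filter; exact: fc.
rewrite subr0 => /eqP; rewrite subr_eq => /eqP ->.
by rewrite gerDr mulr_le0_ge0// ?df0// ltW.
Qed.

Lemma cst_of_derive0 f : (forall x : R, 0 < x -> is_derive x 1 f 0) ->
  f x @[x --> 0^'+] --> f 0 -> forall x, 0 <= x -> f x = f 0.
Proof.
move=> fd f0 x x0; apply/le_anti/andP; split.
  exact: (le_at0_of_derive_le0 _ (fun=> 0)).
rewrite -lerN2; apply: (le_at0_of_derive_le0 (fun y => - f y) (fun=> 0)) => //.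
  by move=> y y0; have := is_deriveN (fd y y0); rewrite oppr0.
exact: cvgN.
Qed.
End derivative_tools.

(** * The tail and integrals of bounded functions *)

Definition tail_prob {R : realType} (nu : probability R R) (x : R) : R :=
  fine (nu `]x, +oo[%classic).

Lemma tail_prob_noninc (R : realType) (nu : probability R R) (x y : R) :
  x <= y -> tail_prob nu y <= tail_prob nu x.
Proof.
move=> xy; rewrite /tail_prob fine_le ?fin_num_measure//.
by rewrite le_measure ?inE//; exact: subitvPl.
Qed.

Definition bounded_measurable {R : realType} (f : R -> R) :=
  measurable_fun setT f /\ exists M, forall w, `|f w| <= M.

Section bounded_measurable_theory.
Context {R : realType}.
Implicit Types f g : R -> R.

Lemma bounded_measurable_cst (c : R) : bounded_measurable (fun _ => c).
Proof. by split=> //; exists `|c|. Qed.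

Lemma bounded_measurableD f g : bounded_measurable f -> bounded_measurable g ->
  bounded_measurable (fun w => f w + g w).
Proof.
move=> [mf [M fM]] [mg [N gN]]; split; first exact: measurable_funD.
by exists (M + N) => w; rewrite (le_trans (ler_normD _ _))// lerD.
Qed.

Lemma bounded_measurableM f g : bounded_measurable f -> bounded_measurable g ->
  bounded_measurable (fun w => f w * g w).
Proof.
move=> [mf [M fM]] [mg [N gN]]; split; first exact: measurable_funM.
by exists (M * N) => w; rewrite normrM ler_pM.
Qed.

Lemma bounded_measurableZ (c : R) f : bounded_measurable f ->
  bounded_measurable (fun w => c * f w).
Proof. by move=> bf; apply: bounded_measurableM => //; exact: bounded_measurable_cst. Qed.

Lemma bounded_measurableB f g : bounded_measurable f -> bounded_measurable g ->
  bounded_measurable (fun w => f w - g w).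
Proof.
move=> bf [mg [N gN]]; apply: bounded_measurableD => //; split.
  exact: measurableT_comp.
by exists N => w; rewrite normrN.
Qed.

Lemma bounded_measurable_bool (b : R -> bool) : measurable_fun setT b ->
  bounded_measurable (fun w => (b w)%:R).
Proof.
move=> mb; split.
  rewrite (_ : (fun w => _) = fun w => if b w then 1 else 0); last first.
    by apply/funext => w; case: (b w).
  exact: measurable_fun_ifT.
by exists 1 => w; case: (b w); rewrite /= ?normr1 ?normr0.
Qed.

Lemma bounded_measurable_gt (x : R) : bounded_measurable (fun w => (x < w)%R%:R).
Proof. by apply: bounded_measurable_bool; exact: measurable_fun_ltr. Qed.

Lemma bounded_measurable_le (x : R) : bounded_measurable (fun w => (w <= x)%R%:R).
Proof. by apply: bounded_measurable_bool; exact: measurable_fun_ler. Qed.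

Lemma bounded_measurable_integrable (nu : probability R R) f :
  bounded_measurable f -> nu.-integrable setT (EFin \o f).
Proof.
move=> [mf [M fM]]; apply: measurable_bounded_integrable => //.
  exact: (le_lt_trans (probability_le1 nu measurableT) (ltry _)).
exists M; split; first by rewrite num_real.
by move=> x Mx w _ /=; rewrite (le_trans (fM w))// ltW.
Qed.

Lemma EFin_Rintegral (nu : probability R R) f : bounded_measurable f ->
  (\int[nu]_w (f w)%:E)%E = (\int[nu]_w f w)%:E.
Proof.
move=> bf; rewrite /Rintegral fineK//; apply: integrable_fin_num => //.
exact: bounded_measurable_integrable.
Qed.

Lemma Rintegral_gt (nu : probability R R) (x : R) :
  \int[nu]_w (x < w)%R%:R = tail_prob nu x.
Proof.
rewrite /tail_prob -[X in nu X]setIT -integral_indic//; congr fine.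
by apply: eq_integral => w _; rewrite indic_itvoy.
Qed.

Lemma bounded_measurable_dominated_cvg (nu : probability R R) (f_ : nat -> R -> R) f M :
  (forall n, measurable_fun setT (f_ n)) -> measurable_fun setT f ->
  (forall n w, `|f_ n w| <= M) ->
  (forall w, f_ n w @[n --> \oo] --> f w) ->
  \int[nu]_w f_ n w @[n --> \oo] --> \int[nu]_w f w.
Proof.
move=> mf_ mf fM ff.
have fM' w : `|f w| <= M.
  have h : `|f_ n w| @[n --> \oo] --> `|f w| by apply: cvg_norm; exact: ff.
  rewrite -(cvg_lim _ h)//; apply: limr_le; first by apply/cvg_ex; exists `|f w|.
  by apply: nearW => n.
apply: fine_cvg; rewrite -/(Rintegral nu setT f) -EFin_Rintegral; last first.
  by split=> //; exists M.
have [] // := @dominated_convergence _ _ _ nu setT measurableT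
  (fun n w => (f_ n w)%:E) (fun w => (f w)%:E) (cst M%:E).
- by move=> n; exact/measurable_EFinP.
- exact/measurable_EFinP.
- by apply: aeW => w _; apply: cvg_EFin; [exact: nearW | exact: ff].
- apply: (@bounded_measurable_integrable nu (cst M)).
  exact: bounded_measurable_cst.
- by apply: aeW => w n _; rewrite lee_fin.
Qed.
End bounded_measurable_theory.

(** * Balance of flows through a level *)

(** Draining clamps at 0, so a negative start follows the same path as 0. Bounds proved for w >= 0
    thus extend to every real w, with no null-set argument on the transition function, whose
    measurability in w is not established. *)
Lemma transition_max0 (R : realType) (r e : R -> R) (t w : R) (A : set R) :
  0 <= t -> transition r e t (Num.max 0 w) A = transition r e t w A.
Proof.
move=> t0; have dE s : 0 <= s -> drain (Num.max 0 w) s = drain w s.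
  move=> s0; rewrite /drain; have [//|w0] := leP 0 w.
  by rewrite sub0r !max_l// ?oppr_le0// subr_le0 (le_trans (ltW w0)).
have sE s : 0 <= s -> survival r (Num.max 0 w) s = survival r w s.
  move=> s0; rewrite /survival; congr (expR (- _)); apply: eq_Rintegral => u.
  by rewrite inE/= in_itv/= => /andP[u0 _]; rewrite dE.
apply: eq_eseriesr => -[|n] _.
  by rewrite /= (dE _ t0) (sE _ t0).
apply: eq_integral => s; rewrite inE/= in_itv/= => /andP[s0 _].
by rewrite (dE _ s0) (sE _ s0).
Qed.

Section level_crossing.
Context {R : realType} (nu : probability R R) (r : R -> R) (C mu : R).
Hypothesis nu0 : nu `]-oo, 0[%classic = 0%E.
Hypothesis mu0 : 0 < mu.
Hypothesis r0C : forall w, 0 <= r w <= C.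
Hypothesis mr : measurable_fun setT r.
Hypothesis r_noninc : forall x y, 0 < x -> x <= y -> r y <= r x.
Hypothesis r_cont : forall x : R, 0 < x -> r y @[y --> x] --> r x.
Hypothesis nu_stat : stationary r (exponential_pdf mu) nu.

Local Notation Fb := (tail_prob nu).

Let C0 : 0 <= C.
Proof. by have /andP[] := r0C 0; exact: le_trans. Qed.

(* Oscillation of the rate over the states met while draining from [w] during
   time [t]. *)
Definition rate_modulus (t w : R) :=
  if w <= 0 then 0 else if w <= t then C else r (w - t) - r w.

(** For w <= x the job tail e^(- mu (x - w)) factors; with e^(- mu x) taken out, the integrand
    depends on the level only through the cut at x. [upcrossing_rate] is the g of the overview. *)
Definition upcrossing_weight (x w : R) := (w <= x)%R%:R * (r w * expR (mu * w)).

Definition upcrossing_mass (x : R) := \int[nu]_w upcrossing_weight x w.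

Definition upcrossing_rate (x : R) := expR (- mu * x) * upcrossing_mass x.

Lemma rate_modulus_bounds t w : 0 <= t -> 0 <= rate_modulus t w <= C.
Proof.
move=> t0; rewrite /rate_modulus; case: ifPn; first by rewrite lexx.
rewrite -ltNge => w0; case: ifPn; first by rewrite lexx C0.
rewrite -ltNge => wt; rewrite subr_ge0 r_noninc ?subr_gt0// ?gerBl//=.
have /andP[_ h] := r0C (w - t); have /andP[h' _] := r0C w; lra.
Qed.

Lemma rate_modulusP t w s : 0 <= t -> 0 <= w -> 0 <= s <= t ->
  r w - rate_modulus t w <= r (drain w s) <= r w + rate_modulus t w.
Proof.
move=> t0 w0 /andP[s0 st]; have /andP[r1 r2] := r0C (drain w s); have /andP[r3 r4] := r0C w.
rewrite /rate_modulus; case: ifPn => [w0'|].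
  have -> : w = 0 by apply/le_anti; rewrite w0 w0'.
  by rewrite /drain sub0r max_l ?oppr_le0// subr0 addr0 lexx.
rewrite -ltNge => w0'; case: ifPn => [wt|]; first by lra.
rewrite -ltNge => wt.
have -> : drain w s = w - s by rewrite /drain max_r// subr_ge0 ltW// (le_lt_trans st).
have : r w <= r (w - s) by rewrite r_noninc ?gerBl// subr_gt0 (le_lt_trans st).
have : r (w - s) <= r (w - t) by rewrite r_noninc ?subr_gt0// lerD2l lerN2.
by lra.
Qed.

Lemma bounded_measurable_rate_modulus t : 0 <= t -> bounded_measurable (rate_modulus t).
Proof.
move=> t0; split; last first.
  by exists C => w; have /andP[? ?] := rate_modulus_bounds t w t0; rewrite ger0_norm.
apply: measurable_fun_ifT => //; first exact: measurable_fun_ler.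
apply: measurable_fun_ifT => //; first exact: measurable_fun_ler.
apply: measurable_funB => //; apply: measurableT_comp => //.
exact: measurable_funB.
Qed.

Lemma bounded_measurable_upcrossing_weight x : bounded_measurable (upcrossing_weight x).
Proof.
split.
  apply: measurable_funM; first by case: (bounded_measurable_le x).
  apply: measurable_funM => //; apply: measurableT_comp => //.
exists (C * expR (mu * x)) => w; have /andP[r1 r2] := r0C w.
rewrite ger0_norm /upcrossing_weight; last by rewrite !mulr_ge0 ?expR_ge0.
have [wx|wx] := leP w x; last by rewrite mul0r mulr_ge0 ?expR_ge0.
by rewrite mul1r ler_pM ?expR_ge0// ler_expR ler_pM2l.
Qed.

Lemma level_crossing_expansion x t : 0 <= x -> 0 <= t -> C * t <= 1 / 2 -> mu * t <= 1 ->
  `| Fb x - Fb (x + t) - t * upcrossing_rate x | <=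
  t * (2 * (\int[nu]_w rate_modulus t w) + (5 * C ^+ 2 + C * mu) * t
       + C * (Fb x - Fb (x + t))).
Proof.
move=> x0 t0 Ct mut; set K := 5 * C ^+ 2 + C * mu.
pose base w := (x + t < w)%R%:R + t * expR (- mu * x) * upcrossing_weight x w.
pose err w := 2 * rate_modulus t w + K * t + C * ((x < w)%R%:R - (x + t < w)%R%:R).
have bm_base : bounded_measurable base.
  apply: bounded_measurableD; first exact: bounded_measurable_gt.
  exact/bounded_measurableZ/bounded_measurable_upcrossing_weight.
have bm_err : bounded_measurable err.
  apply: bounded_measurableD; first apply: bounded_measurableD.
  - exact/bounded_measurableZ/bounded_measurable_rate_modulus.
  - exact: bounded_measurable_cst.
  - by apply: bounded_measurableZ; apply: bounded_measurableB; exact: bounded_measurable_gt.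
have expansion w : (((base (Num.max 0 w) - t * err (Num.max 0 w))%:E <=
    transition r (exponential_pdf mu) t w `]x, +oo[%classic <=
    (base (Num.max 0 w) + t * err (Num.max 0 w))%:E)%E).
  rewrite -transition_max0//; have : 0 <= Num.max 0 w by rewrite le_max lexx.
  move: (Num.max 0 w) => {}w w0.
  have /andP[dl0 _] := rate_modulus_bounds t w t0.
  have := transition_expansion r C mu w x t (rate_modulus t w) r0C mu0 w0 x0 t0 dl0
    (fun s => rate_modulusP t w s t0 w0) Ct mut.
  rewrite /base /err /upcrossing_weight -/K.
  rewrite [t * expR _ * _](_ : _ =
    t * ((w <= x)%R%:R * (r w * exponential_tail mu (x - w)))); last first.
    have [wx|wx] := leP w x; last by rewrite !mul0r !mulr0.
    rewrite /exponential_tail max_r ?subr_ge0//.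
    by rewrite (_ : - mu * (x - w) = - mu * x + mu * w) ?expRD; ring.
  rewrite (_ : (x < w)%R%:R - _ = (x < w <= x + t)%R%:R)//.
  have [xw|xw] := ltP x w; have [xtw|xtw] := ltP (x + t) w; rewrite /= ?subrr ?subr0//.
  by exfalso; lra.
(* The main and error terms, unlike the transition function, are known to be measurable, so the
   clamp is undone on the null set of negative states. *)
have max0E (f : R -> R) : bounded_measurable f ->
    (\int[nu]_w (f (Num.max 0 w))%:E = (\int[nu]_w f w)%:E)%E.
  move=> bf; rewrite -EFin_Rintegral//; case: bf => mf _; apply: ae_eq_integral => //.
  - apply/measurable_EFinP; apply: measurableT_comp => //.
    exact: measurable_maxr.
  - exact/measurable_EFinP.
  - exists `]-oo, 0[%classic; split => // w /=; rewrite in_itv/=.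
    by have [|//] := leP 0 w => w0 h; exfalso; apply: h => _.
have FbE : (Fb x)%:E = (\int[nu]_w transition r (exponential_pdf mu) t w `]x, +oo[%classic)%E.
  by rewrite /tail_prob fineK; [exact/esym/nu_stat | exact: fin_num_measure].
have lower : \int[nu]_w (base w - t * err w) <= Fb x.
  rewrite -lee_fin FbE.
  rewrite -max0E; last exact/bounded_measurableB/bounded_measurableZ.
  by apply: le_integral_pointwise => w _; case/andP: (expansion w).
have upper : Fb x <= \int[nu]_w (base w + t * err w).
  rewrite -lee_fin FbE.
  rewrite -max0E; last exact/bounded_measurableD/bounded_measurableZ.
  by apply: le_integral_pointwise => w _; case/andP: (expansion w).
have I := bounded_measurable_integrable nu.
have baseE : \int[nu]_w base w = Fb (x + t) + t * upcrossing_rate x.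
  rewrite RintegralD//; [|exact/I/bounded_measurable_gt|].
    rewrite RintegralZl//; last exact/I/bounded_measurable_upcrossing_weight.
    by rewrite Rintegral_gt /upcrossing_rate mulrA.
  exact/I/bounded_measurableZ/bounded_measurable_upcrossing_weight.
have errE : \int[nu]_w err w =
    2 * (\int[nu]_w rate_modulus t w) + K * t + C * (Fb x - Fb (x + t)).
  have b1 := bounded_measurable_rate_modulus t t0.
  have b2 := bounded_measurableB _ _ (bounded_measurable_gt x) (bounded_measurable_gt (x + t)).
  have b3 := bounded_measurable_cst (K * t).
  rewrite RintegralD//; [|exact/I/bounded_measurableD/b3/bounded_measurableZ
    |exact/I/bounded_measurableZ].
  rewrite RintegralD//; [|exact/I/bounded_measurableZ|exact/I].
  have -> : \int[nu]__ (K * t) = K * t.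
    by rewrite Rintegral_cst// [X in fine X]probability_setT mulr1.
  rewrite !RintegralZl//; [|exact/I|exact/I].
  rewrite RintegralB//; [|exact/I/bounded_measurable_gt|exact/I/bounded_measurable_gt].
  by rewrite !Rintegral_gt.
have tE : \int[nu]_w (t * err w) = t * \int[nu]_w err w.
  by rewrite RintegralZl//; exact/I.
have bte : nu.-integrable setT (EFin \o (fun w => t * err w)) by exact/I/bounded_measurableZ.
move: lower; rewrite (RintegralB measurableT (I _ bm_base) bte) tE => lower.
move: upper; rewrite (RintegralD measurableT (I _ bm_base) bte) tE => upper.
move: lower upper.
by rewrite baseE errE ler_norml => ? ?; apply/andP; split; lra.
Qed.

(** For fixed w > 0 one has t < w eventually, and continuity of r at w applies. At w = 0 draining
    does not move the state, so the atom contributes nothing. *)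
Lemma Rintegral_rate_modulus_cvg0 : \int[nu]_w rate_modulus t w @[t --> 0^'+] --> 0.
Proof.
apply/cvg_at_rightP => u [u0 uc].
have -> : 0 = \int[nu]_w (fun _ : R => 0 : R) w by rewrite Rintegral_cst// mul0r.
apply: (@bounded_measurable_dominated_cvg _ nu _ _ C) => //.
- by move=> n; case: (bounded_measurable_rate_modulus (u n) (ltW (u0 n))).
- move=> n w; have /andP[? ?] := rate_modulus_bounds (u n) w (ltW (u0 n)).
  by rewrite ger0_norm.
move=> w; have [w0|w0] := leP w 0.
  by rewrite /rate_modulus w0; exact: cvg_cst.
have : r (w - u n) - r w @[n --> \oo] --> r w - r w.
  apply: cvgB; last exact: cvg_cst.
  have wu : w - u n @[n --> \oo] --> w.
    by rewrite -[X in _ --> X]subr0; apply: cvgB => //; exact: cvg_cst.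
  exact: (cvg_comp _ _ wu (r_cont w w0)).
rewrite subrr; apply: cvg_trans; apply: near_eq_cvg.
near=> n; rewrite /rate_modulus leNgt w0/= leNgt.
by rewrite (_ : u n < w)//; near: n; exact: (cvgr_lt 0).
Unshelve. all: by end_near. Qed.

Hypothesis Fb_cont : forall x : R, 0 < x -> Fb y @[y --> x] --> Fb x.

Lemma upcrossing_mass_increment lo hi x y : x <= y ->
  (forall w, x < w -> w <= y -> lo <= r w * expR (mu * w) <= hi) ->
  lo * (Fb x - Fb y) <= upcrossing_mass y - upcrossing_mass x <= hi * (Fb x - Fb y).
Proof.
move=> xy lohi; have I := bounded_measurable_integrable nu.
have bw := bounded_measurable_upcrossing_weight.
have bg := @bounded_measurable_gt R.
have iE c : c * (Fb x - Fb y) = \int[nu]_w (c * ((x < w)%R%:R - (y < w)%R%:R)).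
  rewrite RintegralZl//; last exact/I/bounded_measurableB.
  by rewrite RintegralB//; [rewrite !Rintegral_gt|exact/I|exact/I].
have iz c : nu.-integrable setT (EFin \o (fun w => c * ((x < w)%R%:R - (y < w)%R%:R))).
  exact/I/bounded_measurableZ/bounded_measurableB.
have -> : upcrossing_mass y - upcrossing_mass x =
    \int[nu]_w (upcrossing_weight y w - upcrossing_weight x w).
  by rewrite RintegralB//; exact/I.
have id : nu.-integrable setT
    (EFin \o (fun w => upcrossing_weight y w - upcrossing_weight x w)).
  exact/I/bounded_measurableB.
have key w : lo * ((x < w)%R%:R - (y < w)%R%:R) <=
    upcrossing_weight y w - upcrossing_weight x w <=
    hi * ((x < w)%R%:R - (y < w)%R%:R).
  rewrite /upcrossing_weight; have [wx|wx] := leP w x.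
    by rewrite (le_trans wx xy) ltNge (le_trans wx xy)/= !subrr !mulr0 lexx.
  have [wy|wy] := leP w y; last by rewrite /= subrr !mul0r !mulr0 subrr lexx.
  by rewrite /= mul1r mul0r !subr0 !mulr1 lohi.
by rewrite !iE; apply/andP; split; apply: le_Rintegral => // w _; case/andP: (key w).
Qed.

(** Between the two points r(w) e^(mu w) is a nonincreasing factor times an increasing one. It
    therefore lies between the two cross products on the right-hand side, and so does r(x) e^(mu x).
    Absolute values cover both orders of x and y. *)
Lemma upcrossing_mass_approx x y : 0 < x -> 0 < y ->
  `|upcrossing_mass y - upcrossing_mass x - r x * expR (mu * x) * (Fb x - Fb y)| <=
  `|Fb x - Fb y| * `|r x * expR (mu * y) - r y * expR (mu * x)|.
Proof.
move=> x0 y0.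
have rx0 : 0 <= r x by case/andP: (r0C x).
have ry0 : 0 <= r y by case/andP: (r0C y).
have ex0 := expR_ge0 (mu * x); have ey0 := expR_ge0 (mu * y).
have [xy|yx] := leP x y.
  have D0 : 0 <= Fb x - Fb y by rewrite subr_ge0 tail_prob_noninc.
  have rxy := r_noninc x y x0 xy.
  have exy : expR (mu * x) <= expR (mu * y) by rewrite ler_expR ler_pM2l.
  have h1 : r y * expR (mu * x) <= r x * expR (mu * x) by rewrite ler_wpM2r.
  have h2 : r x * expR (mu * x) <= r x * expR (mu * y) by rewrite ler_wpM2l.
  have := upcrossing_mass_increment (r y * expR (mu * x)) (r x * expR (mu * y)) x y xy.
  case/(_ _)/andP => [w xw wy|l1 l2].
    have w0 := lt_trans x0 xw.
    have [rw0 _] := andP (r0C w).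
    have [rwy rxw] := (r_noninc w y w0 wy, r_noninc x w x0 (ltW xw)).
    by apply/andP; split; rewrite ler_pM ?expR_ge0// ler_expR ler_pM2l// ltW.
  rewrite (ger0_norm D0) [X in _ <= _ * X]ger0_norm; last by rewrite subr_ge0 (le_trans h1).
  have h3 := ler_wpM2r D0 h1; have h4 := ler_wpM2r D0 h2.
  by rewrite ler_norml; apply/andP; split; lra.
have D0 : 0 <= Fb y - Fb x by rewrite subr_ge0 tail_prob_noninc// ltW.
have rxy := r_noninc y x y0 (ltW yx).
have exy : expR (mu * y) <= expR (mu * x) by rewrite ler_expR ler_pM2l// ltW.
have h1 : r x * expR (mu * y) <= r x * expR (mu * x) by rewrite ler_wpM2l.
have h2 : r x * expR (mu * x) <= r y * expR (mu * x) by rewrite ler_wpM2r.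
have := upcrossing_mass_increment (r x * expR (mu * y)) (r y * expR (mu * x)) y x (ltW yx).
case/(_ _)/andP => [w xw wy|l1 l2].
  have w0 := lt_trans y0 xw.
  have [rw0 _] := andP (r0C w).
  have [rwx ryw] := (r_noninc w x w0 wy, r_noninc y w y0 (ltW xw)).
  by apply/andP; split; rewrite ler_pM ?expR_ge0// ler_expR ler_pM2l// ltW.
rewrite [`|Fb x - Fb y|]distrC (ger0_norm D0) [X in _ <= _ * X]distrC.
rewrite [X in _ <= _ * X]ger0_norm; last by rewrite subr_ge0 (le_trans h1).
have h3 := ler_wpM2r D0 h1; have h4 := ler_wpM2r D0 h2.
by rewrite ler_norml; apply/andP; split; lra.
Qed.

Lemma upcrossing_mass_cont (x : R) :
  0 < x -> upcrossing_mass y @[y --> x] --> upcrossing_mass x.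
Proof.
move=> x0; set c := r x * expR (mu * x).
pose D y := `|Fb x - Fb y| * `|r x * expR (mu * y) - r y * expR (mu * x)|
  + `|c * (Fb x - Fb y)|.
have expc := cvg_expRM mu x.
have Dc : Fb x - Fb y @[y --> x] --> 0.
  by rewrite -(subrr (Fb x)); apply: cvgB; [exact: cvg_cst | exact: Fb_cont].
have D0 : D y @[y --> x] --> 0.
  suff : D y @[y --> x] -->
      `|0 : R| * `|r x * expR (mu * x) - r x * expR (mu * x)| + `|c * 0 : R|.
    by rewrite mulr0 normr0 mul0r addr0.
  apply: cvgD; last by apply: cvg_norm; apply: cvgM; [exact: cvg_cst|].
  apply: cvgM; first exact: cvg_norm.
  apply: cvg_norm; apply: cvgB; apply: cvgM => //; try exact: cvg_cst.
  exact: r_cont.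
apply/cvgrPdist_le => eps eps0; near=> y.
have y0 : 0 < y by near: y; exact: lt_nbhsr.
have := upcrossing_mass_approx x y x0 y0; rewrite -/c => h.
have : `|D y| <= eps by near: y; exact: (cvgr0_norm_le _ D0).
rewrite ger0_norm ?addr_ge0 ?mulr_ge0//; apply: le_trans.
rewrite distrC -[X in `|X|](subrK (c * (Fb x - Fb y))) (le_trans (ler_normD _ _))//.
by rewrite lerD.
Unshelve. all: by end_near. Qed.

Lemma upcrossing_rate_cont (x : R) :
  0 < x -> upcrossing_rate y @[y --> x] --> upcrossing_rate x.
Proof.
by move=> x0; apply: cvgM; [exact: cvg_expRM | exact: upcrossing_mass_cont].
Qed.

(** Monotonicity of the rate is assumed only on ]0, +oo[, so the cross products are replaced by the
    crude bounds 0 and C e^mu, valid for w in ]0, 1]. *)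
Lemma upcrossing_mass_right_cont0 : Fb y @[y --> 0^'+] --> Fb 0 ->
  upcrossing_mass y @[y --> 0^'+] --> upcrossing_mass 0.
Proof.
move=> F0; have D0 : C * expR mu * (Fb 0 - Fb y) @[y --> 0^'+] --> 0.
  have : C * expR mu * (Fb 0 - Fb y) @[y --> 0^'+] --> C * expR mu * (Fb 0 - Fb 0).
    by apply: cvgM; [exact: cvg_cst | apply: cvgB => //; exact: cvg_cst].
  by rewrite subrr mulr0.
apply/cvgrPdist_le => eps eps0; near=> y.
have y0 : 0 < y by near: y; exact: nbhs_right_gt.
have y1 : y <= 1 by near: y; exact: nbhs_right_le.
have /andP[h1 h2] : 0 * (Fb 0 - Fb y) <= upcrossing_mass y - upcrossing_mass 0
    <= C * expR mu * (Fb 0 - Fb y).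
  apply: upcrossing_mass_increment => [|w w0 wy]; first exact: ltW.
  have /andP[r1 r2] := r0C w.
  rewrite mulr_ge0 ?expR_ge0//= ler_pM ?expR_ge0// ler_expR.
  by rewrite -[leRHS]mulr1 ler_pM2l// (le_trans wy).
rewrite mul0r in h1; rewrite distrC ger0_norm// (le_trans h2)// (le_trans (ler_norm _))//.
by near: y; exact: (cvgr0_norm_le _ D0).
Unshelve. all: by end_near. Qed.

(** The expansion runs forward in time and yields the increment of the tail above its starting
    level. For h < 0 it is used from x + h during - h, which produces g(x + h); this is why
    continuity of g is established beforehand. *)
Lemma is_derive_tail (x : R) : 0 < x -> is_derive x 1 Fb (- upcrossing_rate x).
Proof.
move=> x0; pose D t := 2 * (\int[nu]_w rate_modulus t w) + (5 * C ^+ 2 + C * mu) * t.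
have D0 : D t @[t --> 0^'+] --> 0.
  rewrite -[X in _ --> X](_ : 2 * 0 + (5 * C ^+ 2 + C * mu) * 0 = 0);
    last by rewrite !mulr0 addr0.
  apply: cvgD; apply: cvgM; try exact: cvg_cst.
    exact: Rintegral_rate_modulus_cvg0.
  by apply: cvg_at_right_filter; exact: cvg_id.
apply: (is_derive_squeeze _ (fun h => D `|h| + C * `|Fb (x + h) - Fb x|
  + `|upcrossing_rate (x + h) - upcrossing_rate x|)).
  have cvg_diff (f : R -> R) : f y @[y --> x] --> f x -> `|f (x + h) - f x| @[h --> 0^'] --> 0.
    move=> fc; have : `|f (x + h) - f x| @[h --> 0^'] --> `|f x - f x|.
      by apply: cvg_norm; apply: cvgB; [exact: cvg_shift_dnbhs0 | exact: cvg_cst].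
    by rewrite subrr normr0.
  rewrite -[X in _ --> X](_ : 0 + C * 0 + 0 = 0); last by rewrite mulr0 !addr0.
  apply: cvgD; first apply: cvgD.
  - exact: (cvg_comp _ _ (@cvg_normr_dnbhs0 R) D0).
  - by apply: cvgM; [exact: cvg_cst | exact/cvg_diff/Fb_cont].
  - exact/cvg_diff/upcrossing_rate_cont.
near=> h.
have hx : `|h| < x by near: h; exact: dnbhs0_lt.
(* The denominator is C + 1 because C may be 0. *)
have Ch : `|h| <= (1 / 2) / (C + 1).
  by near: h; apply: dnbhs0_le; rewrite divr_gt0// ltr_wpDl.
have muh : `|h| <= mu^-1 by near: h; apply: dnbhs0_le; rewrite invr_gt0.
have Ch' : C * `|h| <= 1 / 2.
  have : (C + 1) * `|h| <= 1 / 2 by rewrite mulrC -ler_pdivlMr// ltr_wpDl.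
  by rewrite mulrDl mul1r; have := normr_ge0 h; lra.
have muh' : mu * `|h| <= 1 by rewrite mulrC -ler_pdivlMr// div1r.
have [h0|h0] := leP 0 h.
  move: Ch' muh'; rewrite ger0_norm// => Ch' muh'.
  have := level_crossing_expansion x h (ltW x0) h0 Ch' muh'; rewrite -/(D h).
  have F0 : 0 <= Fb x - Fb (x + h) by rewrite subr_ge0 tail_prob_noninc// lerDl.
  rewrite [`|Fb _ - Fb _|]distrC [`|Fb _ - Fb _|]ger0_norm//.
  rewrite (_ : Fb (x + h) - Fb x - h * - _ =
    - (Fb x - Fb (x + h) - h * upcrossing_rate x)); last by ring.
  rewrite normrN => /le_trans; apply; rewrite ler_wpM2l// lerDl//.
move: Ch' muh' hx; rewrite ltr0_norm// => Ch' muh' hx.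
have xh0 : 0 <= x + h by lra.
have h0' : 0 <= - h by lra.
have := level_crossing_expansion (x + h) (- h) xh0 h0' Ch' muh'; rewrite -/(D (- h)) addrK.
have F0 : 0 <= Fb (x + h) - Fb x by rewrite subr_ge0 tail_prob_noninc// gerDl ltW.
rewrite [`|Fb (x + h) - Fb x|]ger0_norm// => bd.
rewrite (_ : Fb (x + h) - Fb x - h * - _ =
  (Fb (x + h) - Fb x - - h * upcrossing_rate (x + h)) +
  - h * (upcrossing_rate (x + h) - upcrossing_rate x)); last by ring.
apply: (le_trans (ler_normD _ _)); rewrite [leRHS]mulrDr lerD//.
by rewrite normrM (ger0_norm h0').
Unshelve. all: by end_near. Qed.

Lemma is_derive_upcrossing_mass (x : R) : 0 < x ->
  is_derive x 1 upcrossing_mass (r x * expR (mu * x) * upcrossing_rate x).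
Proof.
move=> x0; set c := r x * expR (mu * x); set g := upcrossing_rate x.
pose q h := h^-1 * (Fb (x + h) - Fb x).
pose Dl h := `|r x * expR (mu * (x + h)) - r (x + h) * expR (mu * x)|.
have qg : q h @[h --> 0^'] --> - g by apply: is_derive_cvg; exact: is_derive_tail.
have Dl0 : Dl h @[h --> 0^'] --> 0.
  have : Dl h @[h --> 0^'] --> `|c - c|.
    apply: cvg_norm.
    apply: (cvg_shift_dnbhs0 (fun y => r x * expR (mu * y) - r y * expR (mu * x))).
    apply: cvgB; apply: cvgM; try exact: cvg_cst; last exact: r_cont.
    exact: cvg_expRM.
  by rewrite subrr normr0.
apply: (is_derive_squeeze _ (fun h => `|q h| * Dl h + c * `|q h + g|)).
  rewrite -[X in _ --> X](_ : `|- g| * 0 + c * `|- g + g| = 0); last first.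
    by rewrite addNr normr0 !mulr0 addr0.
  apply: cvgD; apply: cvgM => //; try exact: cvg_cst; apply: cvg_norm => //.
  by apply: cvgD => //; exact: cvg_cst.
near=> h.
have h0 : h != 0 by near: h; exact: nbhs_dnbhs_neq.
have hx : `|h| < x by near: h; exact: dnbhs0_lt.
have xh0 : 0 < x + h by move: hx; rewrite ltr_norml => /andP[]; lra.
have FE : Fb x - Fb (x + h) = - (h * q h) by rewrite /q mulVKf// opprB.
have := upcrossing_mass_approx x (x + h) x0 xh0; rewrite -/c -/(Dl h) FE => bd.
have c0 : 0 <= c by rewrite mulr_ge0 ?expR_ge0//; case/andP: (r0C x).
rewrite (_ : _ - h * (c * g) = (upcrossing_mass (x + h) - upcrossing_mass x - c * - (h * q h))
  + - (h * (c * (q h + g)))); last by ring.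
apply: (le_trans (ler_normD _ _)); rewrite [leRHS]mulrDr; apply: lerD.
  by rewrite (le_trans bd)// normrN normrM mulrA.
by rewrite normrN 2!normrM (ger0_norm c0).
Unshelve. all: by end_near. Qed.

Lemma is_derive_upcrossing_rate (x : R) : 0 < x ->
  is_derive x 1 upcrossing_rate ((r x - mu) * upcrossing_rate x).
Proof.
move=> x0.
have dH := is_derive_upcrossing_mass x x0.
have := is_deriveM (is_derive_expRM (- mu) x) dH; rewrite /GRing.scale/= => dM.
apply: (is_derive_eq dM).
rewrite /upcrossing_rate.
have e1 : expR (- mu * x) * expR (mu * x) = 1 by rewrite -expRD mulNr addNr expR0.
transitivity (r x * (expR (- mu * x) * expR (mu * x)) *
    (expR (- mu * x) * upcrossing_mass x) -
  mu * (expR (- mu * x) * upcrossing_mass x)); first by ring.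
by rewrite e1; ring.
Qed.
End level_crossing.

(** * Solving the Bernoulli equation *)

Section bernoulli_equation.
Context {R : realType} (F g : R -> R) (m : nat) (lam mu pi0 : R).
(** This is d - 1, so the power [n.+1] is d. *)
Let n := m.+1.
Hypothesis mu0 : 0 < mu.
Hypothesis lam0 : 0 < lam.
Hypothesis pi01 : 0 < pi0 <= 1.
Hypothesis F01 : forall x, 0 <= F x <= 1.
Hypothesis F_cvg0 : F k%:R @[k --> \oo] --> 0.
Hypothesis F_noninc : forall x y, x <= y -> F y <= F x.
Hypothesis dF : forall x : R, 0 < x -> is_derive x 1 F (- g x).
Hypothesis dg : forall x : R, 0 < x ->
  is_derive x 1 g ((lam * n.+1%:R * pi0 * F x ^+ n - mu) * g x).
Hypothesis F_right : F y @[y --> 0^'+] --> F 0.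
Hypothesis g_right : g y @[y --> 0^'+] --> g 0.
Hypothesis g0 : g 0 = lam * (1 - pi0 * F 0 ^+ n.+1).

Let rho := lam / mu.

Lemma first_integral x : 0 <= x ->
  g x = mu * F x - lam * pi0 * F x ^+ n.+1 + (lam - mu * F 0).
Proof.
move=> x0; pose Z y := g y - mu * F y + lam * pi0 * F y ^+ n.+1.
have -> : g x = mu * F x - lam * pi0 * F x ^+ n.+1 + Z x by rewrite /Z; ring.
rewrite (_ : Z x = Z 0); first by rewrite /Z g0; ring.
apply: cst_of_derive0 => // [y y0|]; last first.
  apply: cvgD; first by apply: cvgB => //; apply: cvgM => //; exact: cvg_cst.
  apply: cvgM; first exact: cvg_cst.
  exact: (cvg_comp _ _ F_right (@exprn_continuous R n.+1 (F 0))).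
have dX := is_deriveX_fun F n.+1 y _ (dF y y0).
have dZ := is_deriveD (is_deriveB (dg y y0) (is_deriveZ mu (dF y y0)))
  (is_deriveZ (lam * pi0) dX).
apply: (is_derive_eq dZ).
by rewrite /GRing.scale/=; ring.
Qed.

(* The constant of the first integral is the limit of [g], hence of the slope of
   [- F], at infinity; it vanishes since [F] is bounded. *)
Lemma tail_at0 : F 0 = rho.
Proof.
suff : lam - mu * F 0 = 0.
  by move/eqP; rewrite subr_eq0 => /eqP h; rewrite /rho h mulrC mulKf// gt_eqF.
set K := lam - _.
(* By the mean value theorem some c between k and k + 1 has g(c) = F(k) - F(k + 1). The summands 1,
   mu and lam bound this difference, mu F(c) and lam pi0 F(c)^(n + 1), in units of F(k). *)
have KF k : `|K| <= (1 + mu + lam) * F k%:R.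
  have k0 : 0 <= k%:R :> R by [].
  have kk : k%:R < k%:R + 1 :> R by rewrite ltrDl.
  have [||c] := @MVT _ F (fun y => - g y) (k%:R) (k%:R + 1) kk.
  - by move=> y; rewrite in_itv/= => /andP[ky _]; apply: dF; exact: le_lt_trans ky.
  - have Fc y : 0 < y -> {for y, continuous F}.
      by move=> /dF dFy; apply/differentiable_continuous/derivable1_diffP.
    apply/continuous_within_itvP => //; split => //.
    + by move=> y; rewrite in_itv/= => /andP[ky _]; apply: Fc; exact: le_lt_trans ky.
    (* For k = 0 the left end is 0, where right continuity is the hypothesis [F_right]. *)
    + case: k {k0 kk} => [|k] //; apply: cvg_at_right_filter; exact: Fc.
    + by apply: cvg_at_left_filter; apply: Fc; rewrite ltr_wpDl.
  rewrite in_itv/= => /andP[kc ck].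
  rewrite addrAC subrr add0r mulr1 first_integral ?(le_trans k0 (ltW kc))// -/K => eqK.
  have /andP[Fc0 Fc1] := F01 c; have /andP[Fk0 Fk1] := F01 k%:R.
  have /andP[Fs0 Fs1] := F01 (k%:R + 1).
  have Fck : F c <= F k%:R by apply: F_noninc; exact: ltW.
  have Fsk : F (k%:R + 1) <= F k%:R by apply: F_noninc; exact: ltW.
  have p1 : 0 <= lam * pi0 * F c ^+ n.+1 <= lam * F k%:R.
    have /andP[pi0_gt0 pi0_le1] := pi01.
    have lam_ge0 := ltW lam0; have pi0_ge0 := ltW pi0_gt0.
    apply/andP; split; first exact: (mulr_ge0 (mulr_ge0 lam_ge0 pi0_ge0) (exprn_ge0 _ Fc0)).
    rewrite -mulrA ler_wpM2l//.
    rewrite -[leRHS]mul1r ler_pM ?exprn_ge0 ?(ltW pi0_gt0)//.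
    by apply: le_trans Fck; rewrite exprS ler_piMr// exprn_ile1.
  have p2 : 0 <= mu * F c <= mu * F k%:R by rewrite mulr_ge0 ?(ltW mu0)//= ler_wpM2l// ltW.
  have -> : K = F k%:R - F (k%:R + 1) - mu * F c + lam * pi0 * F c ^+ n.+1 by move: eqK; lra.
  by rewrite ler_norml; case/andP: p1 => ? ?; case/andP: p2 => ? ?; apply/andP; split; lra.
have : (1 + mu + lam) * F k%:R @[k --> \oo] --> 0.
  by rewrite -[X in _ --> X](mulr0 (1 + mu + lam)); apply: cvgM => //; exact: cvg_cst.
move=> h; apply/eqP; rewrite -normr_eq0 eq_le normr_ge0 andbT.
rewrite -(cvg_lim _ h)//; apply: limr_ge; first by apply/cvg_ex; exists 0.
by apply: nearW => k; exact: KF.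
Qed.

Lemma bernoulli_solution x : 0 <= x ->
  F x ^+ n * (rho * pi0 + (rho ^- n - rho * pi0) * expR (n%:R * mu * x)) = 1.
Proof.
move=> x0; have rho0 : 0 < rho by rewrite divr_gt0.
have /andP[pi0_gt0 pi0_le1] := pi01.
pose Y y := rho * pi0 + (rho ^- n - rho * pi0) * expR (n%:R * mu * y).
pose Q y := F y ^+ n * Y y.
pose M := n%:R * mu * rho * pi0.
(* The Gronwall functional: Q' = M F^n (Q - 1) and 0 <= F^n <= 1, so the weight e^(- 2 M y) makes
   this square nonincreasing; it starts at 0. *)
pose V y := (Q y - 1) ^+ 2 * expR (- 2 * M * y).
have Q0 : Q 0 = 1.
  rewrite /Q /Y mulr0 expR0 mulr1 addrC subrK tail_at0.
  by rewrite mulfV// expf_neq0// gt_eqF.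
have dY (y : R) : is_derive y 1 Y (n%:R * mu * (Y y - rho * pi0)).
  have dE := is_deriveZ (rho ^- n - rho * pi0) (is_derive_expRM (n%:R * mu) y).
  have dS := is_deriveD (is_derive_cst (rho * pi0) y 1) dE.
  by apply: (is_derive_eq dS); rewrite /GRing.scale/= /Y; ring.
have dQ (y : R) : 0 < y -> is_derive y 1 Q (M * F y ^+ n * (Q y - 1)).
  move=> y0; have dP := is_deriveM (is_deriveX_fun F n y _ (dF y y0)) (dY y).
  apply: (is_derive_eq dP); rewrite /GRing.scale/= /Q /M first_integral ?ltW// tail_at0.
  have lamE : lam = rho * mu by rewrite /rho divfK// gt_eqF.
  rewrite [mu * rho]mulrC -lamE subrr addr0 /n !exprS lamE; ring.
have dV (y : R) : 0 < y -> is_derive y 1 V (2 * M * (F y ^+ n - 1) * V y).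
  move=> y0; have dS : is_derive y 1 (fun z => Q z - 1) (M * F y ^+ n * (Q y - 1)).
    by apply: (is_derive_eq (is_deriveB (dQ y y0) (is_derive_cst (1 : R) y 1))); rewrite subr0.
 
  have dP := is_deriveM (is_deriveX_fun _ 2%N y _ dS) (is_derive_expRM (- 2 * M) y).
  by apply: (is_derive_eq dP); rewrite /GRing.scale/= /V; ring.
have M0 : 0 <= M.
  exact: (mulr_ge0 (mulr_ge0 (mulr_ge0 (ler0n _ _) (ltW mu0)) (ltW rho0)) (ltW pi0_gt0)).
have V0 : V x <= V 0.
  apply: (le_at0_of_derive_le0 _ _ dV) => // [y y0|].
    have /andP[f0 f1] := F01 y.
    apply: mulr_le0_ge0; last by rewrite mulr_ge0 ?sqr_ge0 ?expR_ge0.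
    by apply: mulr_ge0_le0; [exact: mulr_ge0 | rewrite subr_le0 exprn_ile1].
  apply: cvgM; last by apply: cvg_at_right_filter; exact: cvg_expRM.
  have Qr : Q y - 1 @[y --> 0^'+] --> Q 0 - 1.
    apply: cvgB; last exact: cvg_cst; apply: cvgM.
      exact: (cvg_comp _ _ F_right (@exprn_continuous R n (F 0))).
    apply: cvgD; first exact: cvg_cst; apply: cvgM; first exact: cvg_cst.
    by apply: cvg_at_right_filter; exact: cvg_expRM.
  exact: (cvg_comp _ _ Qr (@exprn_continuous R 2 (Q 0 - 1))).
have : (Q x - 1) ^+ 2 <= 0.
  rewrite -(pmulr_lle0 _ (expR_gt0 (- 2 * M * x))) -/(V x) (le_trans V0)//.
  by rewrite /V Q0 subrr expr0n mul0r.
by rewrite le_eqVlt ltNge sqr_ge0 orbF sqrf_eq0 subr_eq0 => /eqP.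
Qed.
End bernoulli_equation.

(** * Sharing ties among the sampled queues *)

(** Pascal's rule, read as conditioning on the first of n + 1 draws: a tie, of weight p, raises the
    count by one. The sum p + q may be less than 1, as a draw below w contributes 0. *)
Lemma binomial_mean_recl (R : comNzRingType) (p q : R) (n : nat) (c : nat -> R) :
  \sum_(k < n.+2) 'C(n.+1, k)%:R * p ^+ k * q ^+ (n.+1 - k) * c k =
  p * (\sum_(k < n.+1) 'C(n, k)%:R * p ^+ k * q ^+ (n - k) * c k.+1) +
  q * (\sum_(k < n.+1) 'C(n, k)%:R * p ^+ k * q ^+ (n - k) * c k).
Proof.
have -> : q * (\sum_(k < n.+1) 'C(n, k)%:R * p ^+ k * q ^+ (n - k) * c k) =
    \sum_(k < n.+2) 'C(n, k)%:R * p ^+ k * q ^+ (n.+1 - k) * c k.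
  rewrite [RHS]big_ord_recr/= bin_small// !mul0r addr0 mulr_sumr.
  apply: eq_bigr => k _; rewrite subSn ?exprS; last by rewrite -ltnS.
  by move: 'C(n, k)%:R (p ^+ k) (q ^+ (n - k)) => a b e; ring.
rewrite !(big_ord_recl n.+1) /= !bin0 addrCA; congr (_ + _).
rewrite mulr_sumr -big_split/=; apply: eq_bigr => k _.
rewrite /bump/= add1n binS natrD subSS exprS.
by move: 'C(n, k)%:R 'C(n, k.+1)%:R (p ^+ k) (q ^+ (n - k)) => a a' b e; ring.
Qed.

(** From (n + 1) C(n, k) = (k + 1) C(n + 1, k + 1). By symmetry, both sides give the probability
    that the minimum of n + 1 i.i.d. workloads is exactly w, where p = P(W = w) and q = P(W > w). *)
Lemma binomial_mean_invS (R : realFieldType) (p q : R) (n : nat) :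
  n.+1%:R * p * (\sum_(k < n.+1) 'C(n, k)%:R * p ^+ k * q ^+ (n - k) * k.+1%:R^-1) =
  (p + q) ^+ n.+1 - q ^+ n.+1.
Proof.
have -> : (p + q) ^+ n.+1 - q ^+ n.+1 =
    \sum_(k < n.+1) q ^+ (n - k) * p ^+ k.+1 *+ 'C(n.+1, k.+1).
  rewrite [p + q]addrC exprDn big_ord_recl/= bin0 subn0 expr0 mulr1 mulr1n.
  by rewrite addrAC subrr add0r.
rewrite mulr_sumr; apply: eq_bigr => k _; rewrite exprS -[in RHS]mulr_natr.
have := congr1 (fun z => z%:R : R) (mul_bin_diag n.+1 k); rewrite /= !natrM => e.
transitivity (p * p ^+ k * q ^+ (n - k) * (n.+1%:R * 'C(n, k)%:R) * k.+1%:R^-1).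
  by move: 'C(n, k)%:R (p ^+ k) (q ^+ (n - k)) => a b e'; ring.
rewrite e; have : k.+1%:R != 0 :> R by rewrite pnatr_eq0.
by move: k.+1%:R 'C(n.+1, k.+1)%:R (p ^+ k) (q ^+ (n - k)) => a b c' e' a0; field.
Qed.

(** The weight [c] is arbitrary because the induction shifts it by one when the first draw is a
    tie. *)
Lemma iid_expectation_ties (R : realType) (nu : probability R R) (w : R)
    (n : nat) (c : nat -> R) :
  iid_expectation nu n (fun vs =>
    (if all (fun v => w <= v) vs then c (count_mem w vs) else 0)%:E) =
  (\sum_(k < n.+1) 'C(n, k)%:R * fine (nu [set w]) ^+ k *
     fine (nu `]w, +oo[%classic) ^+ (n - k) * c k)%:E.
Proof.
elim: n c => [|n IH] c.
  by rewrite /= big_ord_recl big_ord0 /= bin0 !expr0 !mul1r addr0.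
set p := fine _; set q := fine _; rewrite binomial_mean_recl.
set S1 := (X in p * X + _); set S2 := (X in _ + q * X).
pose b v := S1 * (v == w)%R%:R + S2 * (w < v)%R%:R.
have beq : bounded_measurable (fun v : R => (v == w)%R%:R).
  by apply: bounded_measurable_bool; exact: measurable_fun_eqr.
have bgt := bounded_measurable_gt w.
have I := bounded_measurable_integrable nu.
transitivity (\int[nu]_v (b v)%:E)%E.
  apply: eq_integral => v _; rewrite /b.
  have [vw|wv|->] := ltgtP v w.
  (* A draw below w annihilates the share; the hypothesis at weight 0 evaluates the remaining zero
     expectation. *)
  - have := IH (fun=> 0); rewrite [in RHS]big1 => [z|k _]; last by rewrite mulr0.
    rewrite !mulr0 addr0 -z; congr iid_expectation; apply/funext => vs /=.
    by rewrite leNgt vw/=; case: ifP.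
  - rewrite mulr0 mulr1 add0r -IH; congr iid_expectation; apply/funext => vs /=.
    by rewrite (ltW wv) gt_eqF.
  - rewrite mulr0 mulr1 addr0 -(IH (fun k => c k.+1)).
    congr iid_expectation; apply/funext => vs /=.
    by rewrite lexx eqxx.
rewrite EFin_Rintegral; last by apply: bounded_measurableD; exact: bounded_measurableZ.
congr EFin; rewrite RintegralD//; [|exact/I/bounded_measurableZ|exact/I/bounded_measurableZ].
rewrite !RintegralZl//; [|exact/I|exact/I].
rewrite Rintegral_gt [p * _]mulrC [q * _]mulrC; congr (_ * _ + _).
rewrite /p -[X in nu X]setIT -integral_indic//; congr fine.
by apply: eq_integral => v _; rewrite indicE in_set1.
Qed.

(** * Continuity of the tail and the rate at equilibrium *)

(** The left limit is P(W >= x), which exceeds the tail by the mass of x. *)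
Lemma tail_prob_left_cont (R : realType) (nu : probability R R) (x : R) :
  nu [set x] = 0%E -> tail_prob nu y @[y --> x^'-] --> tail_prob nu x.
Proof.
move=> nux; apply/cvg_at_leftP => u [ux uc].
have bge : bounded_measurable (fun w => (x <= w)%R%:R).
  by apply: bounded_measurable_bool; exact: measurable_fun_ler.
have -> : tail_prob nu x = \int[nu]_w (x <= w)%R%:R.
  have -> : \int[nu]_w (x <= w)%R%:R = fine (nu `[x, +oo[%classic).
    rewrite -[X in nu X]setIT -integral_indic//; congr fine.
    by apply: eq_integral => w _; rewrite indicE mem_setE in_itv/= andbT.
  rewrite -(@setU1itv _ _ _ _ false)// measureU//; last first.
    by apply/seteqP; split => // y [/= ->]; rewrite in_itv/= ltxx.
  by rewrite [X in _ = fine (X + _)%E](_ : _ = 0%E)// add0e.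
under eq_fun do rewrite -Rintegral_gt.
apply: (bounded_measurable_dominated_cvg nu _ _ 1).
- by move=> n; case: (bounded_measurable_gt (u n)).
- by case: bge.
- by move=> n w; case: (_ < _); rewrite /= ?normr1 ?normr0.
move=> w; have [xw|wx] := leP x w.
  have : (true%:R : R) @[_ --> \oo] --> (true%:R : R) by exact: cvg_cst.
  apply: cvg_trans; apply: near_eq_cvg; apply: nearW => n.
  by rewrite /= (lt_le_trans (ux n) xw).
have : (false%:R : R) @[_ --> \oo] --> (false%:R : R) by exact: cvg_cst.
apply: cvg_trans; apply: near_eq_cvg.
near=> n; rewrite /= ltNge (_ : w <= u n)//.
by near: n; exact: (cvgr_ge x).
Unshelve. all: by end_near. Qed.

Section equilibrium_rate.
Context {R : realType} (nu : probability R R) (n : nat) (lam pi0 : R).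
Hypothesis lam0 : 0 < lam.
Hypothesis pi01 : 0 < pi0 <= 1.
Hypothesis nu_neg : nu `]-oo, 0[%classic = 0%E.
Hypothesis nu_atom0 : (0 < nu [set 0%R])%E.
Hypothesis nu_atom : forall x : R, 0 < x -> nu [set x] = 0%E.

Local Notation Fb := (tail_prob nu).
Let r := arrival_rate n.+1 lam pi0 nu.
Let pi0_ge0 : 0 <= pi0. Proof. by case/andP: pi01 => /ltW. Qed.

Lemma tail_bounds x : 0 <= Fb x <= 1.
Proof.
rewrite /tail_prob fine_ge0//= -lee_fin fineK ?fin_num_measure//.
exact: probability_le1.
Qed.

Let p0_gt0 : 0 < fine (nu [set 0%R]).
Proof. by rewrite fine_gt0// nu_atom0 ltey_eq fin_num_measure. Qed.

Lemma atom0D_tail0 : fine (nu [set 0%R]) + Fb 0 = 1.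
Proof.
rewrite /tail_prob -fineD ?fin_num_measure// -measureU//; last first.
  by apply/seteqP; split => // y [/= ->]; rewrite in_itv/= ltxx.
rewrite setU1itv//.
have := @probability_setC _ _ _ nu `]-oo, 0[%classic (measurable_itv _).
by rewrite setCitvl nu_neg sube0 => e; rewrite [X in fine X]e.
Qed.

Lemma join_probE w : join_prob n.+1 nu w =
  \sum_(k < n.+1) 'C(n, k)%:R * fine (nu [set w]) ^+ k * Fb w ^+ (n - k) * k.+1%:R^-1.
Proof. by rewrite /join_prob/= (iid_expectation_ties _ nu w n (fun k => k.+1%:R^-1)). Qed.

Lemma join_prob_no_atom w : nu [set w] = 0%E -> join_prob n.+1 nu w = Fb w ^+ n.
Proof.
move=> w0; rewrite join_probE w0/= big_ord_recl/= big1 => [|k _]; last first.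
  by rewrite expr0n/= mulr0 !mul0r.
by rewrite bin0 expr0 !mul1r subn0 invr1 mulr1 addr0.
Qed.

Lemma rateE w : w != 0 -> r w = lam * n.+1%:R * pi0 * Fb w ^+ n.
Proof.
move=> w0; rewrite /r /arrival_rate (negbTE w0) addr0 join_prob_no_atom//.
have [/nu_atom//|wlt0|w0'] := ltgtP 0 w; last by rewrite w0' eqxx in w0.
apply/eqP; rewrite eq_le measure_ge0 andbT -nu_neg.
by rewrite le_measure ?inE// => y ->; rewrite /= in_itv.
Qed.

(** Potential arrivals give lam pi0 (1 - F(0)^d) by the tie identity with p + q = 1. Memory arrivals
    give lam (1 - pi0), since the denominator 1 - F(0) is the mass of the atom. *)
Lemma rate0E : fine (nu [set 0%R]) * r 0 = lam * (1 - pi0 * Fb 0 ^+ n.+1).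
Proof.
rewrite /r /arrival_rate eqxx join_probE.
set S := \sum_(k < _) _; have := binomial_mean_invS _ (fine (nu [set 0%R])) (Fb 0) n.
rewrite -/S atom0D_tail0 expr1n => e.
rewrite -/(Fb 0) (_ : 1 - Fb 0 = fine (nu [set 0%R])); last first.
  by rewrite -atom0D_tail0 addrK.
move: p0_gt0 e; move: (fine (nu [set 0%R])) => p pgt0 e.
have pn0 : p != 0 by rewrite gt_eqF.
transitivity (lam * pi0 * (n.+1%:R * p * S) + lam * (1 - pi0)).
  by move: n.+1%:R S {e} => N S; field.
by rewrite e; ring.
Qed.

Lemma rate0_ge0 : 0 <= r 0.
Proof.
have /andP[pi0_gt0 pi0_le1] := pi01.
rewrite -(pmulr_rge0 _ p0_gt0) rate0E mulr_ge0 ?(ltW lam0)// subr_ge0.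
have /andP[F0 F1] := tail_bounds 0.
by rewrite mulr_ile1 ?exprn_ge0 ?exprn_ile1.
Qed.

Lemma rate_bounds w : 0 <= r w <= lam * n.+1%:R * pi0 + r 0.
Proof.
have a0 : 0 <= lam * n.+1%:R * pi0 by rewrite !mulr_ge0 ?(ltW lam0).
have [->|w0] := eqVneq w 0; first by rewrite rate0_ge0 lerDr.
have /andP[F0 F1] := tail_bounds w.
rewrite rateE// mulr_ge0 ?exprn_ge0//= (@le_trans _ _ (lam * n.+1%:R * pi0))//.
  by rewrite ler_piMr// exprn_ile1.
by rewrite lerDl rate0_ge0.
Qed.

Lemma measurable_rate : measurable_fun setT r.
Proof.
rewrite (_ : r = fun w => if w == 0 then r 0 else lam * n.+1%:R * pi0 * Fb w ^+ n); last first.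
  by apply/funext => w; case: eqVneq => [->//|]; exact: rateE.
apply: measurable_fun_ifT => //; first exact: measurable_fun_eqr.
apply: measurable_funM => //; apply: measurable_funX.
apply: nonincreasing_measurable => // x y; exact: tail_prob_noninc.
Qed.

Lemma rate_noninc x y : 0 < x -> x <= y -> r y <= r x.
Proof.
move=> x0 xy; rewrite !rateE ?gt_eqF// ?(lt_le_trans x0)//.
have /andP[Fy0 _] := tail_bounds y.
rewrite ler_wpM2l ?mulr_ge0 ?(ltW lam0)// lerXn2r ?nnegrE ?tail_prob_noninc//.
by rewrite (le_trans Fy0)// tail_prob_noninc.
Qed.

Lemma rate_cont (x : R) : 0 < x -> Fb y @[y --> x] --> Fb x -> r y @[y --> x] --> r x.
Proof.
move=> x0 Fx; rewrite rateE ?gt_eqF//.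
have : lam * n.+1%:R * pi0 * Fb y ^+ n @[y --> x] --> lam * n.+1%:R * pi0 * Fb x ^+ n.
  apply: cvgM; first exact: cvg_cst.
  exact: (cvg_comp _ _ Fx (@exprn_continuous R n (Fb x))).
apply: cvg_trans; apply: near_eq_cvg; near=> y.
by rewrite rateE// gt_eqF//; near: y; exact: lt_nbhsr.
Unshelve. all: by end_near. Qed.

(** The cut w <= 0 leaves only the atom, so g(0) is its mass times r(0). *)
Lemma upcrossing_rate0 mu : 0 < mu ->
  upcrossing_rate nu r mu 0 = lam * (1 - pi0 * Fb 0 ^+ n.+1).
Proof.
move=> mu0; rewrite /upcrossing_rate mulr0 expR0 mul1r /upcrossing_mass -rate0E.
have beq : bounded_measurable (fun v : R => (v == 0)%R%:R).
  by apply: bounded_measurable_bool; exact: measurable_fun_eqr.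
transitivity (\int[nu]_w (r 0 * (w == 0)%R%:R)).
  congr fine; apply: ae_eq_integral => //.
  - apply/measurable_EFinP.
    by have [] := bounded_measurable_upcrossing_weight r _ mu mu0 rate_bounds
      measurable_rate 0.
  - apply/measurable_EFinP; by have [] := bounded_measurableZ (r 0) _ beq.
  - exists `]-oo, 0[%classic; split => // w /=; rewrite in_itv/= => h.
    rewrite ltNge; apply/negP => w0; apply: h => _; rewrite /upcrossing_weight.
    have [->|wn0] := eqVneq w 0; first by rewrite lexx mulr0 expR0 mulr1 mul1r.
    by rewrite leNgt lt_neqAle eq_sym wn0 w0/= mul0r mulr0.
rewrite RintegralZl//; last exact: bounded_measurable_integrable.
rewrite mulrC; congr (_ * _); rewrite -[X in nu X]setIT -integral_indic//; congr fine.
by apply: eq_integral => v _; rewrite indicE in_set1.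
Qed.
End equilibrium_rate.

(** * The closed form of the tail *)

Theorem corollary1 (R : realType) (disp : measure_display)
    (T : measurableType disp) (P : probability T R) (W : {RV P >-> R})
    (d : nat) (lam mu rho pi0 : R) :
  (2 <= d)%N -> 0 < mu -> rho = lam / mu -> 0 < rho < 1 -> 0 < pi0 <= 1 ->
  equilibrium_workload d lam mu pi0 (distribution P W) ->
  forall w : R, 0 <= w ->
    ccdf W w =
    ((rho * pi0 +
      (rho `^ (1 - d%:R) - rho * pi0) * expR ((d%:R - 1) * mu * w))
       `^ (1 / (1 - d%:R)))%:E.
Proof.
case: d => [|[|m]]// _ mu0 rhoE /andP[rho0 rho1] pi01.
move=> [nu_neg nu_atom0 [f [mf f0 nuf]] nu_stat] w w0.
set nu : probability R R := distribution P W in nu_neg nu_atom0 nuf nu_stat.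
have ccdfE x : ccdf W x = (tail_prob nu x)%:E by rewrite /tail_prob fineK ?fin_num_measure.
have lam0 : 0 < lam.
  have -> : lam = rho * mu by rewrite rhoE divfK// gt_eqF.
  exact: mulr_gt0.
have nu_atom x : 0 < x -> nu [set x] = 0%E.
  move=> x0; rewrite nuf//; last by move=> _ ->; rewrite /= in_itv/= x0.
  exact: integral_set1.
have F_right x : tail_prob nu y @[y --> x^'+] --> tail_prob nu x.
  have := @ccdf_right_continuous _ _ _ P W x.
  rewrite ccdfE => /fine_cvg; apply: cvg_trans; apply: near_eq_cvg; apply: nearW => y.
  by rewrite /= ccdfE.
have F_cont (x : R) : 0 < x -> tail_prob nu y @[y --> x] --> tail_prob nu x.
  move=> x0; apply/left_right_continuousP; split => //.
  exact: tail_prob_left_cont (nu_atom x x0).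
have F_cvg0 : tail_prob nu k%:R @[k --> \oo] --> 0.
  have ccdf0 : ccdf W k%:R @[k --> \oo] --> 0%E.
    exact: (cvg_comp _ _ (@cvgr_idn R) (@cvg_ccdfy0 _ _ _ P W)).
  have : fine (ccdf W k%:R) @[k --> \oo] --> (0 : R) by exact: fine_cvg ccdf0.
  apply: cvg_trans; apply: near_eq_cvg; apply: nearW => k.
  by rewrite /= ccdfE.
set r := arrival_rate m.+2 lam pi0 nu.
have r_bounds := rate_bounds nu m.+1 lam pi0 lam0 pi01 nu_neg nu_atom0 nu_atom.
have mr := measurable_rate nu m.+1 lam pi0 nu_neg nu_atom.
have r_noninc := rate_noninc nu m.+1 lam pi0 lam0 pi01 nu_neg nu_atom.
have r_cont x x0 := rate_cont nu m.+1 lam pi0 nu_neg nu_atom x x0 (F_cont x x0).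
have dF := is_derive_tail nu r _ mu nu_neg mu0 r_bounds mr r_noninc r_cont nu_stat F_cont.
have dg := is_derive_upcrossing_rate nu r _ mu nu_neg mu0 r_bounds mr r_noninc
  r_cont nu_stat F_cont.
have g0 := upcrossing_rate0 nu m.+1 lam pi0 lam0 pi01 nu_neg nu_atom0 nu_atom mu mu0.
have g_right : upcrossing_rate nu r mu y @[y --> 0^'+] --> upcrossing_rate nu r mu 0.
  apply: cvgM; first by apply: cvg_at_right_filter; exact: cvg_expRM.
  exact: (upcrossing_mass_right_cont0 nu r _ mu mu0 r_bounds mr (F_right 0)).
have dg' (x : R) : 0 < x -> is_derive x 1 (upcrossing_rate nu r mu)
    ((lam * m.+2%:R * pi0 * tail_prob nu x ^+ m.+1 - mu) * upcrossing_rate nu r mu x).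
  move=> x0; rewrite -(rateE nu m.+1 lam pi0 nu_neg nu_atom) ?gt_eqF//.
  exact: dg.
have := bernoulli_solution (tail_prob nu) _ m lam mu pi0 mu0 lam0 pi01 (tail_bounds nu)
  F_cvg0 (tail_prob_noninc _ nu) dF dg' (F_right 0) g_right g0 w w0.
rewrite -rhoE ccdfE => FY; congr EFin.
rewrite (_ : 1 - m.+2%:R = - m.+1%:R :> R); last by rewrite -[m.+2]addn1 natrD; ring.
rewrite (_ : m.+2%:R - 1 = m.+1%:R :> R); last by rewrite -[m.+2]addn1 natrD addrK.
rewrite powR_invn ?(ltW rho0)//.
move: FY; set Y := (_ + _) => FY.
have /andP[F0 F1] := tail_bounds nu w.
(* The identity F^n Y = 1 itself rules out F(w) = 0; hence Y = F^(-n), and the power - 1/n returns F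
   because F >= 0. *)
have Fn0 : tail_prob nu w ^+ m.+1 != 0.
  by apply/eqP => F_eq0; move: FY; rewrite F_eq0 mul0r => /esym/eqP; rewrite oner_eq0.
have -> : Y = tail_prob nu w ^- m.+1 by apply: (mulfI Fn0); rewrite FY mulfV.
rewrite -powR_invn// -powRrM div1r mulfV ?powRr1//.
Qed.
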